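(* There exist universal constants $C,F_2,G_2>0$ such that the following holds. Let $\Theta$ be a positive integer, let $I=[a,b]$, and let $\nu$ be a probability measure on $I$ with density $\nu(x)$. Let $N,m,s$ be positive integers with $$m\ge C s\log^3(s)\log(N+1).$$ Let $\{\psi_0,\psi_1,\dots,\psi_N\}$ be polynomials on $I$ that are orthonormal with respect to $\nu$, whose degrees are strictly increasing and do not exceed $N$. Let $\boldsymbol{\omega}=(\omega_0,\dots,\omega_N)^T$ be a weight vector with $\omega_j\ge\|\psi_j\|_\infty$ for $j=0,1,\dots,N$, and suppose $s\ge 2\|\boldsymbol{\omega}\|_\infty^2$. Let $x_1,\dots,x_m$ be drawn independently from $I$, each with probability density $\nu(x)$, and let $A\in\mathbb{R}^{m\times(N+1)}$ have entries $A_{j,k}=\psi_k(x_j)$, $j=1,\dots,m$, $k=0,\dots,N$. Let $f\in C[a,b]$ be arbitrary, and put $\mathbf{y}=(f(x_1),\dots,f(x_m))^T$. Then, with probability at least $1-(N+1)^{-\log^3(3s)}$, the following holds: if $\mathbf{c}^\#=(c_0^\#,\dots,c_N^\#)^T$ is a solution of $$\min_{\mathbf{z}\in\mathbb{R}^{N+1}}\|\mathbf{z}\|_{\boldsymbol{\omega},1}\quad\text{subject to}\quad\|A\mathbf{z}-\mathbf{y}\|_2\le\Theta\sqrt{m}\,E_N,$$ and $p^\#=\sum_{k=0}^N c_k^\#\psi_k$, then $$\|f-p^\#\|_2\le\|f-p_{opt}\|_2+F_2\frac{\sigma_s(\mathbf{c_{opt}})_{\boldsymbol{\omega},1}}{\sqrt{s}}+\Theta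 G_2E_N.$$ Here $p_{opt}$ is the best uniform approximation polynomial of $f$ in $\Pi_N(I)=\mathrm{span}\{\psi_0,\dots,\psi_N\}$, $\mathbf{c_{opt}}$ is its coefficient vector in the basis $\{\psi_k\}_{k=0}^N$, and $E_N$ is the best uniform approximation error of $f$ in $\Pi_N(I)$.
   Context: $\|g\|_\infty=\max_{x\in[a,b]}|g(x)|$ and, for functions, $\|g\|_2=\left(\int_a^b g(x)^2\nu(x)\,dx\right)^{1/2}$; for vectors $\|\cdot\|_2$ and $\|\cdot\|_\infty$ are the usual $\ell_2$ and max norms. $\Pi_N(I)$ is the space of polynomials on $I$ of degree at most $N$. $E_N=E_N(f)=\inf_{p\in\Pi_N(I)}\|f-p\|_\infty$, and $p_{opt}\in\Pi_N(I)$ satisfies $\|f-p_{opt}\|_\infty=E_N$. Orthonormal with respect to $\nu$ means $\int_I\psi_j(x)\psi_k(x)\nu(x)\,dx=\delta_{jk}$. Weighted notions: weights satisfy $\omega_j\ge1$; $\|\mathbf{z}\|_{\boldsymbol{\omega},1}=\sum_j\omega_j|z_j|$; $\|\mathbf{z}\|_{\boldsymbol{\omega},0}=\sum_{\{j:z_j\ne0\}}\omega_j^2$; the weighted best $s$-term approximation error is $\sigma_s(\mathbf{x})_{\boldsymbol{\omega},1}=\inf\{\|\mathbf{x}-\mathbf{z}\|_{\boldsymbol{\omega},1}:\|\mathbf{z}\|_{\boldsymbol{\omega},0}\le s\}$. ''Universal constants'' means independent of all the other data. *)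

(* Defs.v *)
From HB Require Import structures.
From mathcomp Require Import all_boot all_order all_algebra.
From mathcomp Require Import all_classical all_reals all_analysis.

Set Implicit Arguments.
Unset Strict Implicit.
Unset Printing Implicit Defensive.

Import Order.TTheory GRing.Theory Num.Theory.
Import numFieldNormedType.Exports.

Local Open Scope classical_set_scope.
Local Open Scope ring_scope.

(* A function on [a, b] is a total function R -> R; only its values on [a, b]
   are ever used. *)

(* For g continuous on [a, b] the supremum is attained, so this is
   max_{x in [a, b]} |g x|. *)
Definition supnorm (R : realType) (a b : R) (g : R -> R) : R :=
  sup [set `|g x| | x in `[a, b]%classic].

Definition is_density (R : realType) (a b : R) (nu : R -> R) : Prop :=
  [/\ measurable_fun `[a, b]%classic nu,
      (forall x, x \in `[a, b] -> 0 <= nu x) &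
      (\int[lebesgue_measure]_(x in `[a, b]) (nu x)%:E = 1)%E].

Definition L2norm (R : realType) (a b : R) (nu g : R -> R) : R :=
  Num.sqrt (\int[lebesgue_measure]_(x in `[a, b]) (g x ^+ 2 * nu x)).

Definition orthonormal_wrt (R : realType) (a b : R) (nu : R -> R) (n : nat)
    (psi : 'I_n -> {poly R}) : Prop :=
  forall j k : 'I_n,
    \int[lebesgue_measure]_(x in `[a, b]) ((psi j).[x] * (psi k).[x] * nu x)
      = (j == k)%:R.

(* size p <= N.+1 says that p has degree at most N. *)
Definition best_error (R : realType) (a b : R) (N : nat) (f : R -> R) : R :=
  inf [set supnorm a b (fun x => f x - p.[x])
      | p in [set p : {poly R} | (size p <= N.+1)%N]].

Definition is_best_approx (R : realType) (a b : R) (N : nat) (f : R -> R)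
    (p : {poly R}) : Prop :=
  (size p <= N.+1)%N /\
  supnorm a b (fun x => f x - p.[x]) = best_error a b N f.

Definition lincomb (R : realType) (n : nat) (psi : 'I_n -> {poly R})
    (c : 'cV[R]_n) : {poly R} :=
  \sum_(k < n) c k 0 *: psi k.

Definition l2norm (R : realType) (n : nat) (z : 'cV[R]_n) : R :=
  Num.sqrt (\sum_(j < n) z j 0 ^+ 2).

Definition wl1norm (R : realType) (n : nat) (omega z : 'cV[R]_n) : R :=
  \sum_(j < n) omega j 0 * `|z j 0|.

Definition wl0norm (R : realType) (n : nat) (omega z : 'cV[R]_n) : R :=
  \sum_(j < n | z j 0 != 0) omega j 0 ^+ 2.

Definition wsigma (R : realType) (n s : nat) (omega x : 'cV[R]_n) : R :=
  inf [set wl1norm omega (x - z)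
      | z in [set z : 'cV[R]_n | wl0norm omega z <= s%:R]].

Definition wl1_minimizer (R : realType) (m n : nat) (omega : 'cV[R]_n)
    (A : 'M[R]_(m, n)) (y : 'cV[R]_m) (eta : R) (c : 'cV[R]_n) : Prop :=
  l2norm (A *m c - y) <= eta /\
  (forall z : 'cV[R]_n, l2norm (A *m z - y) <= eta ->
     wl1norm omega c <= wl1norm omega z).

Definition mutually_independent (d : measure_display) (T : measurableType d)
    (R : realType) (P : probability T R) (m : nat)
    (X : 'I_m -> {RV P >-> R}) : Prop :=
  forall (J : {set 'I_m}) (B : 'I_m -> set R),
    (forall i, measurable (B i)) ->
    P (\bigcap_(i in [set` J]) (X i @^-1` B i))
      = (\prod_(i in J) P (X i @^-1` B i))%E.

Definition has_density (d : measure_display) (T : measurableType d)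
    (R : realType) (P : probability T R) (a b : R) (nu : R -> R)
    (X : {RV P >-> R}) : Prop :=
  forall B : set R, measurable B ->
    distribution P X B
      = (\int[lebesgue_measure]_(x in B `&` `[a, b]) (nu x)%:E)%E.

(* The set of outcomes satisfying Q need not be known to be measurable, hence
   the measurable event E contained in it. *)
Definition with_prob_at_least (d : measure_display) (T : measurableType d)
    (R : realType) (P : probability T R) (q : R) (Q : T -> Prop) : Prop :=
  exists E : set T,
    [/\ measurable E, (q%:E <= P E)%E & forall t, E t -> Q t].

(* Main.v *)
(** Put v = c# - c_opt. Minimality of c# gives, for every z of weighted sparsity
    at most s, |v|_{omega,1} <= 2 sqrt(s) |v|_2 + 2 |c_opt - z|_{omega,1}, so
    either |v|_2 is at most |c_opt - z|_{omega,1} / sqrt(s), or v lies in the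
    cone |v|_{omega,1} <= 4 sqrt(s) |v|_2. On the cone it suffices to have
    sum_i p_v(x_i)^2 >= m |v|_2^2 / 100, since |A v|_2 <= 2 Theta sqrt(m) E_N.

    This lower bound, uniform over the cone, is obtained level by level. For
    |v|_2 = 1, the dyadic level sets {|p_v| >= 2^i / 2}, i < n = O(log s), carry
    a constant part of the unit mass of p_v^2. By Maurey's empirical method p_v
    is within 2^i / 8, except on a set that is small for both nu and the
    empirical measure, of an average of L_i = O(4^-i s log s) atoms
    +- 4 sqrt(s) psi_j / omega_j. A Chernoff bound compares the nu-measure and
    the empirical measure of the level sets of these averages, and a union
    bound over the (2 N + 2)^(L_i) averages costs only an additive error e_i
    with sum_i 4^i e_i <= 1/8. *)

Require Import Defs.
From HB Require Import structures.
From mathcomp Require Import all_boot all_order all_algebra.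
From mathcomp Require Import all_classical all_reals all_analysis.
From mathcomp Require Import measurable_realfun ring lra.

Set Implicit Arguments.
Unset Strict Implicit.
Unset Printing Implicit Defensive.

Import Order.TTheory GRing.Theory Num.Theory.
Import numFieldNormedType.Exports.

Local Open Scope classical_set_scope.
Local Open Scope ring_scope.

(** * Exponential tail bounds for averages of independent draws from a finite law *)

Lemma expR_le_quad (R : realType) (x : R) : x <= 1 / 2 ->
  expR x <= 1 + x + 2 * x ^+ 2.
Proof.
move=> hx.
have h1 : 1 - x <= expR (- x) by rewrite expR_ge1Dx.
have h2 : expR x * expR (- x) = 1 by rewrite expRxMexpNx_1.
have h3 : 0 < expR x by rewrite expR_gt0.
have h4 : expR x * (1 - x) <= 1
  by apply: le_trans (_ : _ <= expR x * expR (- x)) _;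
    [rewrite ler_pM2l|rewrite h2].
have h5 : (0 : R) < 1 - x by lra.
(* Here (1 - x)(1 + x + 2 x^2) = 1 + x^2 (1 - 2 x), which is at least 1 for x <= 1/2. *)
rewrite -(ler_pM2r h5); apply: (le_trans h4).
have : 0 <= x ^+ 2 * (1 - 2 * x) by apply: mulr_ge0; [exact: sqr_ge0|lra].
nra.
Qed.

(** When [w] is a probability vector, this is the law of [L] independent draws from it, so that
    expectations over random samples are finite sums. *)
Definition prod_weight (R : realType) (J : finType) (w : J -> R) (L : nat)
    (h : {ffun 'I_L -> J}) : R :=
  \prod_l w (h l).

Lemma prod_weight_ge0 (R : realType) (J : finType) (w : J -> R) L
    (h : {ffun 'I_L -> J}) :
  (forall j, 0 <= w j) -> 0 <= prod_weight w h.
Proof. by move=> w0; apply: prodr_ge0. Qed.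

Lemma sum_prod_weight (R : realType) (J : finType) (w : J -> R) L :
  \sum_j w j = 1 -> \sum_(h : {ffun 'I_L -> J}) prod_weight w h = 1.
Proof.
move=> w1; rewrite -(bigA_distr_bigA (fun (_ : 'I_L) j => w j)) /=.
by rewrite big1.
Qed.

(** Chernoff's method: the indicator of the tail is at most the product over l of exp(lam (Y (h l) -
    mu - eps)). Summed against the product weights, this factors into an L-th power, and the
    quadratic bound on exp controls a single factor. *)
Lemma sampling_tail (R : realType) (J : finType) (w Y : J -> R) (L : nat)
    (B eps : R) :
  (forall j, 0 <= w j) -> \sum_j w j = 1 -> 0 < B -> 0 <= eps <= 4 * B ->
  (forall j, `|Y j| <= B) ->
  \sum_(h : {ffun 'I_L -> J} |
      L%:R * (\sum_j w j * Y j) + L%:R * eps < \sum_l Y (h l)) prod_weight w h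
    <= expR (- (L%:R * eps ^+ 2 / (32 * B ^+ 2))).
Proof.
move=> w0 w1 B0 /andP[e0 eB] YB.
set mu := \sum_j w j * Y j.
(* This value minimizes 8 lam^2 B^2 - lam eps. The assumption eps <= 4 B gives lam B <= 1/4, hence
   lam (Y j - mu) <= 1/2 because |Y j - mu| <= 2 B. *)
set lam := eps / (16 * B ^+ 2).
have B20 : 0 < B ^+ 2 by rewrite exprn_gt0.
have lam0 : 0 <= lam by rewrite /lam divr_ge0 // ltW // mulr_gt0.
have muB : `|mu| <= B.
  apply: le_trans (ler_norm_sum _ _ _) _.
  rewrite -[leRHS]mul1r -w1 mulr_suml; apply: ler_sum => j _.
  by rewrite normrM ger0_norm // ler_wpM2l.
have lamB : lam * B <= 1 / 4.
  rewrite /lam mulrAC ler_pdivrMr ?mulr_gt0 // expr2.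
  have : 0 <= (4 * B - eps) * B by rewrite mulr_ge0 ?subr_ge0 // ltW.
  nra.
pose K j := expR (lam * (Y j - mu - eps)).
apply: (@le_trans _ _ (\sum_(h : {ffun 'I_L -> J}) \prod_l (w (h l) * K (h l)))).
  rewrite big_mkcond /=; apply: ler_sum => h _.
  rewrite big_split /= -/(prod_weight w h).
  have K0 : 0 <= \prod_i K (h i) by apply: prodr_ge0 => i _; exact: expR_ge0.
  case: ifPn => [hh|_]; last by rewrite mulr_ge0 // prod_weight_ge0.
  rewrite -[leLHS]mulr1 ler_wpM2l ?prod_weight_ge0 //.
  rewrite /K -expR_sum -mulr_sumr.
  rewrite -expR0 ler_expR mulr_ge0 //.
  rewrite !big_split /= !sumr_const !card_ord -(mulr_natl (- mu)) -(mulr_natl (- eps)).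
  by move: hh; rewrite -/mu; lra.
rewrite -(bigA_distr_bigA (fun (_ : 'I_L) j => w j * K j)) /=.
rewrite prodr_const card_ord.
have -> : - (L%:R * eps ^+ 2 / (32 * B ^+ 2)) =
          L%:R * (- (eps ^+ 2 / (32 * B ^+ 2))) by rewrite mulrN -mulrA.
rewrite expRM_natl lerXn2r ?nnegrE ?expR_ge0 //.
  by apply: sumr_ge0 => j _; rewrite mulr_ge0 ?expR_ge0.
apply: (@le_trans _ _ ((1 + 8 * lam ^+ 2 * B ^+ 2) * expR (- (lam * eps)))).
  apply: (@le_trans _ _
    (\sum_j w j * (1 + lam * (Y j - mu) + 8 * lam ^+ 2 * B ^+ 2)
       * expR (- (lam * eps)))).
    apply: ler_sum => j _; rewrite -mulrA ler_wpM2l // /K mulrBr expRD.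
    rewrite ler_wpM2r ?expR_ge0 //.
    have yb : `|Y j - mu| <= 2 * B.
      apply: le_trans (ler_normB _ _) _; have := YB j; lra.
    apply: le_trans (expR_le_quad _) _.
      have : lam * (Y j - mu) <= lam * (2 * B).
        by rewrite ler_wpM2l // (le_trans (ler_norm _)).
      lra.
    rewrite lerD2l exprMn.
    have : (Y j - mu) ^+ 2 <= (2 * B) ^+ 2.
      by rewrite -real_normK ?num_real // lerXn2r ?nnegrE // mulr_ge0 // ltW.
    move=> /(ler_wpM2l (sqr_ge0 lam)).
    nra.
  rewrite -mulr_suml ler_wpM2r ?expR_ge0 //.
  under eq_bigr do rewrite mulrDr mulrDr mulr1 mulrCA mulrBr.
  rewrite !big_split /= -!mulr_suml -mulr_sumr sumrB -/mu -mulr_suml w1.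
  lra.
have -> : - (eps ^+ 2 / (32 * B ^+ 2)) = 8 * lam ^+ 2 * B ^+ 2 - lam * eps.
  by rewrite /lam; field; rewrite gt_eqF.
rewrite expRD ler_wpM2r ?expR_ge0 //.
exact: expR_ge1Dx.
Qed.

Lemma sampling_tail_norm (R : realType) (J : finType) (w Y : J -> R) (L : nat)
    (B eps : R) :
  (0 < L)%N ->
  (forall j, 0 <= w j) -> \sum_j w j = 1 -> 0 < B -> 0 <= eps <= 4 * B ->
  (forall j, `|Y j| <= B) ->
  \sum_(h : {ffun 'I_L -> J})
      prod_weight w h *
      (eps < `|(\sum_l Y (h l)) / L%:R - \sum_j w j * Y j|)%R%:R
    <= 2 * expR (- (L%:R * eps ^+ 2 / (32 * B ^+ 2))).
Proof.
move=> L0 w0 w1 B0 eB YB.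
have L0' : 0 < L%:R :> R by rewrite ltr0n.
have h1 := sampling_tail L w0 w1 B0 eB YB.
have YB' j : `|- Y j| <= B by rewrite normrN.
have h2 := sampling_tail L w0 w1 B0 eB YB'.
rewrite mulr_natl mulr2n; apply: le_trans (lerD h1 h2).
rewrite [X in _ <= X + _]big_mkcond [X in _ <= _ + X]big_mkcond -big_split /=.
apply: ler_sum => h _.
have W0 := prod_weight_ge0 h w0.
set W := prod_weight w h in W0 *.
set S := \sum_l Y (h l).
have -> : \sum_l - Y (h l) = - S by rewrite sumrN.
have -> : \sum_j w j * - Y j = - \sum_j w j * Y j.
  by rewrite -sumrN; apply: eq_bigr => j _; rewrite mulrN.
set mu := \sum_j w j * Y j.
case: (boolP (eps < _)%R) => [|_]; last first.
  by rewrite mulr0 addr_ge0 //; case: ifP.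
rewrite mulr1 lter_normr => /orP[] hh.
  have -> : L%:R * mu + L%:R * eps < S.
    by rewrite -mulrDr mulrC -ltr_pdivlMr //; lra.
  by rewrite lerDl; case: ifP.
have -> : L%:R * - mu + L%:R * eps < - S.
  by rewrite -mulrDr mulrC -ltr_pdivlMr // mulNr; lra.
by rewrite lerDr; case: ifP.
Qed.

(** * Lower deviations of the number of sample points in a set *)

Lemma measure_bigsetU_le d (T : measurableType d) (R : realType)
    (P : probability T R) (I : Type) (r : seq I) (p : pred I)
    (F : I -> set T) :
  (forall i, measurable (F i)) ->
  (P (\big[setU/set0]_(i <- r | p i) F i) <= \sum_(i <- r | p i) P (F i))%E.
Proof.
move=> mF.
elim: r => [|i r IH]; first by rewrite !big_nil measure0.
rewrite !big_cons; case: ifP => // _.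
apply: le_trans (leeD2l _ IH).
apply: measureU2 => //; exact: bigsetU_measurable.
Qed.

(** Split the outcomes by the exact set J of indices whose sample falls in S; mutual independence
    gives each pattern a product probability. Bounding the condition |J| <= k by exp(k - |J|), the
    total is at most e^k (1 - q + q/e)^m. The factor 1/2 on q leaves an error linear in e in the
    exponent. *)
Lemma count_lower_tail (d : measure_display) (T : measurableType d)
    (R : realType) (P : probability T R) (m : nat) (X : 'I_m -> {RV P >-> R})
    (S : set R) (q e : R) :
  mutually_independent X -> measurable S -> 0 <= q <= 1 ->
  (forall i, P (X i @^-1` S) = q%:E) ->
  exists E : set T, [/\ measurable E, (P E <= (expR (- (m%:R * e)))%:E)%E &
    forall t, \sum_i \1_S (X i t) <= m%:R * (q / 2 - e) -> E t].
Proof.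
move=> indep mS /andP[q0 q1] PS.
pose k := m%:R * (q / 2 - e).
pose B (J : {set 'I_m}) i := if i \in J then S else ~` S.
have mB J i : measurable (B J i).
  by rewrite /B; case: ifP => // _; exact: measurableC.
pose pat (J : {set 'I_m}) : set T :=
  \bigcap_(i in [set` [set: 'I_m]%SET]) (X i @^-1` (B J i)).
have mXB J i : measurable (X i @^-1` (B J i)).
  exact: measurable_funPTI.
have mpat J : measurable (pat J).
  by apply: fin_bigcap_measurable => [|i _]; [exact: finite_finset|exact: mXB].
have Ppat J : P (pat J) = (\prod_i (if i \in J then q else 1 - q))%:E.
  rewrite /pat indep // -prodEFin.
  apply: eq_big => [i|i _]; first by rewrite inE.
  rewrite /B; case: ifP => // _.
  by rewrite preimage_setC probability_setC ?PS //; exact: measurable_funPTI.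
exists (\big[setU/set0]_(J : {set 'I_m} | #|J|%:R <= k) pat J); split.
- exact: bigsetU_measurable.
- apply: le_trans (measure_bigsetU_le _ _ _ mpat) _.
  under eq_bigr do rewrite Ppat.
  rewrite sumEFin lee_fin.
  apply: (@le_trans _ _ (\sum_(J : {set 'I_m}) expR k *
      \prod_i (if i \in J then q * expR (-1) else 1 - q))).
    rewrite big_mkcond /=; apply: ler_sum => J _.
    have -> : \prod_i (if i \in J then q * expR (-1) else 1 - q) =
        expR (- #|J|%:R) * \prod_i (if i \in J then q else 1 - q) :> R.
      have -> : expR (- #|J|%:R) = \prod_(i in J) expR (-1) :> R.
        by rewrite prodr_const -expRM_natl mulrN1.
      rewrite [X in _ = X * _]big_mkcond -big_split /=; apply: eq_bigr => i _.
      by case: ifP => _; rewrite ?mul1r // mulrC.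
    have p0 : 0 <= \prod_i (if i \in J then q else 1 - q).
      by apply: prodr_ge0 => i _; case: ifP; rewrite // subr_ge0.
    rewrite mulrA -expRD; case: ifP => h; last by rewrite mulr_ge0 ?expR_ge0.
    rewrite -[leLHS]mul1r ler_wpM2r //.
    have : 0 <= k - #|J|%:R by rewrite subr_ge0.
    by rewrite -ler_expR expR0.
  (* The sum over all patterns J is the expansion of (q/e + 1 - q)^m, and each factor is at most
     exp(- q/2) since 1/e <= 1/2. *)
  rewrite -mulr_sumr -bigA_distr prodr_const card_ord.
  have -> : - (m%:R * e) = k + m%:R * (- (q / 2)) by rewrite /k; ring.
  rewrite expRD ler_wpM2l ?expR_ge0 // expRM_natl.
  rewrite lerXn2r ?nnegrE ?expR_ge0 //.
    by rewrite addr_ge0 ?subr_ge0 // mulr_ge0 ?expR_ge0.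
  apply: le_trans (expR_ge1Dx _).
  have : expR (-1) <= 1 / 2 :> R.
    rewrite expRN mul1r lef_pV2 ?posrE ?expR_gt0 //.
    by apply: le_trans (expR_ge1Dx 1); rewrite -natr1.
  move=> /(ler_wpM2l q0) /=; lra.
- move=> t ht.
  pose J : {set 'I_m} := [set i | `[< S (X i t) >]]%SET.
  rewrite -bigcup_seq_cond; exists J.
    rewrite /= mem_index_enum.
    rewrite /=; apply: le_trans ht; rewrite -sum1_card natr_sum big_mkcond.
    apply: ler_sum => i _; rewrite inE indicE.
    by case: asboolP => h; [rewrite mem_set|].
  move=> i _; rewrite /B /= inE; case: asboolP => //.
Qed.

(** * Integration of bounded measurable functions against the density *)

Definition wint (R : realType) (a b : R) (nu h : R -> R) : R :=
  \int[lebesgue_measure]_(x in `[a, b]) (h x * nu x).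

(** This class contains polynomials and indicators and is closed under sums and products; multiplied
    by the density, its members are integrable. It discharges every integrability condition
    below. *)
Definition bdmeas (R : realType) (a b : R) (h : R -> R) : Prop :=
  measurable_fun `[a, b]%classic h /\
  exists M : R, forall x, x \in `[a, b] -> `|h x| <= M.

Section bounded_measurable.
Variables (R : realType) (a b : R).
Implicit Types (h g : R -> R).

Lemma bdmeas_cst c : bdmeas a b (fun => c).
Proof. by split; [exact: measurable_cst|exists `|c|]. Qed.

Lemma bdmeasD h g : bdmeas a b h -> bdmeas a b g ->
  bdmeas a b (fun x => h x + g x).
Proof.
move=> [mh [M hM]] [mg [M' gM]]; split; first exact: measurable_funD.
exists (M + M') => x xab; apply: le_trans (ler_normD _ _) _.
by rewrite lerD ?hM ?gM.
Qed.

Lemma bdmeasM h g : bdmeas a b h -> bdmeas a b g ->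
  bdmeas a b (fun x => h x * g x).
Proof.
move=> [mh [M hM]] [mg [M' gM]]; split; first exact: measurable_funM.
exists (M * M') => x xab; rewrite normrM.
by rewrite ler_pM ?hM ?gM.
Qed.

Lemma bdmeasZ c h : bdmeas a b h -> bdmeas a b (fun x => c * h x).
Proof. exact: bdmeasM (bdmeas_cst c). Qed.

Lemma bdmeasB h g : bdmeas a b h -> bdmeas a b g ->
  bdmeas a b (fun x => h x - g x).
Proof.
move=> hh hg; under [X in bdmeas _ _ X]eq_fun do rewrite -mulN1r.
by apply: bdmeasD => //; exact: bdmeasZ.
Qed.

Lemma bdmeas_sqr h : bdmeas a b h -> bdmeas a b (fun x => h x ^+ 2).
Proof.
by move=> hh; under [X in bdmeas _ _ X]eq_fun do rewrite expr2; exact: bdmeasM.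
Qed.

Lemma bdmeas_sum (I : Type) (r : seq I) (P : pred I) (h : I -> R -> R) :
  (forall i, bdmeas a b (h i)) -> bdmeas a b (fun x => \sum_(i <- r | P i) h i x).
Proof.
move=> hh; elim: r => [|i r IH].
  by under [X in bdmeas _ _ X]eq_fun do rewrite big_nil; exact: bdmeas_cst.
under [X in bdmeas _ _ X]eq_fun do rewrite big_cons.
by case: (P i) => //; exact: bdmeasD.
Qed.

Lemma bdmeas_indic (S : set R) : measurable S -> bdmeas a b \1_S.
Proof.
move=> mS; split; first exact: measurable_indic.
by exists 1 => x _; rewrite indicE; case: (_ \in _); rewrite ?normr1 ?normr0.
Qed.

Lemma continuous_itv_bounded (g : R -> R) :
  a < b -> {within `[a, b], continuous g} ->
  exists M : R, forall x, x \in `[a, b] -> `|g x| <= M.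
Proof.
move=> ab cg.
have [c _ hc] := EVT_max (ltW ab) cg; have [c' _ hc'] := EVT_min (ltW ab) cg.
exists (`|g c| + `|g c'|) => x xab; rewrite ler_norml.
have := hc _ xab; have := hc' _ xab; have := ler_norm (g c).
have := ler_norm (- g c'); rewrite normrN.
have := normr_ge0 (g c); have := normr_ge0 (g c').
move=> ? ? ? ? ? ?; apply/andP; split; lra.
Qed.

Lemma bdmeas_continuous (g : R -> R) :
  a < b -> {within `[a, b], continuous g} -> bdmeas a b g.
Proof.
move=> ab cg; split; last exact: continuous_itv_bounded.
exact: subspace_continuous_measurable_fun.
Qed.

Lemma bdmeas_poly (p : {poly R}) : a < b -> bdmeas a b (fun x => p.[x]).
Proof.
by move=> ab; apply: bdmeas_continuous => //; apply: continuous_subspaceT;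
  exact: continuous_horner.
Qed.

End bounded_measurable.

Section weighted_integral.
Variables (R : realType) (a b : R) (nu : R -> R).
Hypothesis dnu : is_density a b nu.
Implicit Types (h g : R -> R).

Lemma bdmeas_integrable h : bdmeas a b h ->
  (@lebesgue_measure R).-integrable `[a, b] (EFin \o (fun x => h x * nu x)).
Proof.
case: dnu => mnu nu0 nu1 [mh [M hM]].
have inu : (@lebesgue_measure R).-integrable `[a, b] (EFin \o nu).
  apply/integrableP; split; first exact/measurable_EFinP.
  rewrite [X in (X < _)%E](_ : _ = 1%E) ?ltry // -nu1.
  by apply: eq_integral => x; rewrite inE /= => xab; rewrite ger0_norm // nu0.
have mab : measurable (`[a, b]%classic : set (measurableTypeR R)).
  exact: measurable_itv.
apply: (integrableMr mab mh _ inu).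
exists M; split; first exact: num_real.
by move=> y My x xab; apply: le_trans (hM x xab) (ltW My).
Qed.

Lemma wintD h g : bdmeas a b h -> bdmeas a b g ->
  wint a b nu (fun x => h x + g x) = wint a b nu h + wint a b nu g.
Proof.
move=> hh hg; rewrite /wint -RintegralD //; last 2 first.
  exact: bdmeas_integrable.
  exact: bdmeas_integrable.
by apply: eq_Rintegral => x _; rewrite mulrDl.
Qed.

Lemma wintZ c h : bdmeas a b h ->
  wint a b nu (fun x => c * h x) = c * wint a b nu h.
Proof.
move=> hh; rewrite /wint -RintegralZl //; last exact: bdmeas_integrable.
by apply: eq_Rintegral => x _; rewrite mulrA.
Qed.

Lemma wint_cst c : wint a b nu (fun => c) = c.
Proof.
rewrite -[X in wint _ _ _ (fun => X)]mulr1 wintZ; last exact: bdmeas_cst.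
rewrite -[RHS]mulr1; congr (_ * _); rewrite /wint /Rintegral.
case: dnu => _ _ nu1; under eq_integral do rewrite mul1r.
by rewrite nu1.
Qed.

Lemma wint_sum (I : Type) (r : seq I) (P : pred I) (h : I -> R -> R) :
  (forall i, bdmeas a b (h i)) ->
  wint a b nu (fun x => \sum_(i <- r | P i) h i x) =
  \sum_(i <- r | P i) wint a b nu (h i).
Proof.
move=> hh; elim: r => [|i r IH].
  by under [X in wint _ _ _ X]eq_fun do rewrite big_nil; rewrite big_nil wint_cst.
under [X in wint _ _ _ X]eq_fun do rewrite big_cons.
rewrite big_cons; case: (P i) => //.
by rewrite wintD // ?IH //; exact: bdmeas_sum.
Qed.

Lemma le_wint h g : bdmeas a b h -> bdmeas a b g ->
  (forall x, x \in `[a, b] -> h x <= g x) -> wint a b nu h <= wint a b nu g.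
Proof.
move=> hh hg hle; apply: le_Rintegral => //.
- exact: bdmeas_integrable.
- exact: bdmeas_integrable.
- by case: dnu => _ nu0 _ x xab; rewrite ler_wpM2r ?hle ?nu0.
Qed.

Lemma wint_ge0 h : bdmeas a b h -> (forall x, x \in `[a, b] -> 0 <= h x) ->
  0 <= wint a b nu h.
Proof.
by move=> hh h0; rewrite -(wint_cst 0); apply: le_wint => //; exact: bdmeas_cst.
Qed.

Lemma has_density_wint d (T : measurableType d) (P : probability T R)
    (X : {RV P >-> R}) (S : set R) :
  has_density a b nu X -> measurable S ->
  P (X @^-1` S) = (wint a b nu \1_S)%:E.
Proof.
move=> dX mS; have := dX _ mS; rewrite /distribution /pushforward => ->.
rewrite setIC integral_mkcondr /wint /Rintegral fineK; last first.
  apply: integrable_fin_num => //.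
  by apply: bdmeas_integrable; exact: bdmeas_indic.
apply: eq_integral => x _; rewrite /patch indicE.
by case: (_ \in _); rewrite ?mul1r ?mul0r.
Qed.

End weighted_integral.

(** * Level sets of polynomials and dyadic decomposition of a square *)

Lemma measurable_poly_gt (R : realType) (p : {poly R}) (c : R) :
  measurable [set x : R | c < `|p.[x]|].
Proof.
have -> : [set x : R | c < `|p.[x]|] = (fun x => `|p.[x]|) @^-1` `]c, +oo[.
  by apply/seteqP; split => x /=; rewrite in_itv /= andbT.
rewrite -[_ @^-1` _]setTI; apply: measurableT_comp => //.
exact: measurable_poly.
Qed.

Lemma measurable_poly_ge (R : realType) (p : {poly R}) (c : R) :
  measurable [set x : R | c <= `|p.[x]|].
Proof.
have -> : [set x : R | c <= `|p.[x]|] = (fun x => `|p.[x]|) @^-1` `[c, +oo[.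
  by apply/seteqP; split => x /=; rewrite in_itv /= andbT.
rewrite -[_ @^-1` _]setTI; apply: measurableT_comp => //.
exact: measurable_poly.
Qed.

Lemma sum_pow4 (R : realType) n :
  \sum_(i < n) (4 : R) ^+ i = (4 ^+ n - 1) / 3.
Proof.
elim: n => [|n IH]; first by rewrite big_ord0 expr0 subrr mul0r.
by rewrite big_ord_recr /= IH exprS; field.
Qed.

(** A discrete layer-cake formula: 3/4 4^i is the increment of t^2 between t = 2^i / 2 and t =
    2^(i+1) / 2, and 1/4 is the value of t^2 at the lowest threshold. *)
Lemma sqr_le_dyadic (R : realType) n (y : R) : `|y| < 2 ^+ n / 2 ->
  y ^+ 2 <= 1 / 4 + \sum_(i < n) 3 / 4 * 4 ^+ i * (2 ^+ i / 2 <= `|y|)%R%:R.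
Proof.
rewrite -[y ^+ 2]real_normK ?num_real //.
have : 0 <= `|y| by [].
move: `|y| => {}y y0; elim: n => [|n IH] hy.
  rewrite big_ord0 addr0; rewrite expr0 in hy.
  have : y * y <= 1 / 2 * (1 / 2) by rewrite ler_pM // ltW.
  by rewrite expr2; lra.
have [hlt|hge] := ltP y (2 ^+ n / 2).
  apply: (le_trans (IH hlt)).
  rewrite big_ord_recr /= addrA lerDl !mulr_ge0 ?exprn_ge0 //.
rewrite (eq_bigr (fun i : 'I_n.+1 => 3 / 4 * 4 ^+ i)); last first.
  move=> i _; have -> : 2 ^+ i / 2 <= y; last by rewrite mulr1.
  apply: le_trans hge; rewrite ler_pM2r //.
  by rewrite ler_eXn2l ?ltr1n // -ltnS.
rewrite -mulr_sumr sum_pow4.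
have : y ^+ 2 <= (2 ^+ n.+1 / 2) ^+ 2 by rewrite lerXn2r ?nnegrE // ltW.
have -> : (2 ^+ n.+1 / 2) ^+ 2 = 4 ^+ n.+1 / 4 :> R.
  rewrite exprMn -exprM mulnC exprM; congr (_ ^+ _ * _); lra.
by lra.
Qed.

(** The geometric sum is governed by the largest level k with 2^k / 4 <= |y|: it is below 4^(k+1) /
    3, whereas y^2 >= 4^k / 16, and 64/3 <= 22. The thresholds are half those of [sqr_le_dyadic],
    which leaves room for approximation. *)
Lemma dyadic_le_sqr (R : realType) n (y : R) :
  \sum_(i < n) 4 ^+ i * (2 ^+ i / 4 <= `|y|)%R%:R <= 22 * y ^+ 2.
Proof.
rewrite -[y ^+ 2]real_normK ?num_real //.
have : 0 <= `|y| by [].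
move: `|y| => {}y y0; elim: n => [|n IH].
  by rewrite big_ord0 mulr_ge0 ?sqr_ge0.
have [hge|hlt] := boolP (2 ^+ n / 4 <= y)%R; last first.
  by rewrite big_ord_recr /= (negbTE hlt) mulr0 addr0.
apply: (@le_trans _ _ (\sum_(i < n.+1) 4 ^+ i)).
  apply: ler_sum => i _; rewrite -[leRHS]mulr1 ler_wpM2l ?exprn_ge0 //.
  by rewrite lern1 leq_b1.
rewrite sum_pow4.
have : (2 ^+ n / 4) ^+ 2 <= y ^+ 2.
  by rewrite lerXn2r ?nnegrE ?mulr_ge0 ?exprn_ge0.
have -> : (2 ^+ n / 4) ^+ 2 = 4 ^+ n / 16 :> R.
  rewrite exprMn -exprM mulnC exprM; congr (_ ^+ _ * _); lra.
have : 0 <= 4 ^+ n :> R by rewrite exprn_ge0.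
by rewrite (exprS 4); lra.
Qed.

(** * Comparison of nu with the empirical measure for a single polynomial *)

Definition empirical (R : realType) (m : nat) (xs : 'I_m -> R) (S : set R) : R :=
  (\sum_i \1_S (xs i)) / m%:R.

Lemma le_empirical (R : realType) m (xs : 'I_m -> R) (S S1 S2 : set R) :
  S `<=` S1 `|` S2 -> empirical xs S <= empirical xs S1 + empirical xs S2.
Proof.
move=> sub; rewrite /empirical -mulrDl ler_wpM2r ?invr_ge0 // -big_split /=.
apply: ler_sum => i _; rewrite !indicE.
have [/set_mem/sub[]/mem_set -> |_] := boolP (xs i \in S).
- by rewrite lerDl.
- by rewrite lerDr.
- by rewrite addr_ge0.
Qed.

Definition sample_avg (R : realType) (J : finType) (phi : J -> {poly R}) L
    (h : {ffun 'I_L -> J}) : {poly R} :=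
  L%:R^-1 *: \sum_l phi (h l).

Section level_comparison.
Variables (R : realType) (a b : R) (nu : R -> R).
Hypothesis dnu : is_density a b nu.
Let W := wint a b nu.

Lemma le_wint_indic (S S1 S2 : set R) :
  measurable S -> measurable S1 -> measurable S2 ->
  S `<=` S1 `|` S2 -> W \1_S <= W \1_S1 + W \1_S2.
Proof.
move=> mS mS1 mS2 sub.
have hb S' : measurable S' -> bdmeas a b \1_S' by exact: bdmeas_indic.
rewrite /W -wintD; [|exact: dnu|exact: hb|exact: hb].
apply: le_wint; [exact: dnu|exact: hb|by apply: bdmeasD; exact: hb|].
move=> x _; rewrite !indicE.
have [/set_mem/sub[]/mem_set -> |_] := boolP (x \in S).
- by rewrite lerDl.
- by rewrite lerDr.
- by rewrite addr_ge0.
Qed.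

Variables (J : finType) (phi : J -> {poly R}) (w : J -> R) (B : R).
Hypotheses (w0 : forall j, 0 <= w j) (w1 : \sum_j w j = 1) (B0 : 0 < B).
Hypothesis phiB : forall j x, x \in `[a, b] -> `|(phi j).[x]| <= B.
Variables (m : nat) (xs : 'I_m -> R).
Hypotheses (m0 : (0 < m)%N) (xsab : forall i, xs i \in `[a, b]).
Let p := \sum_j w j *: phi j.

(* Maurey's empirical method: a random average of L atoms works on average. *)
Lemma exists_sample_avg L (eps : R) : (0 < L)%N -> 0 <= eps <= 4 * B ->
  exists h : {ffun 'I_L -> J},
    let bad := [set x | eps < `|(sample_avg phi h - p).[x]|] in
    W \1_bad + empirical xs bad <=
      4 * expR (- (L%:R * eps ^+ 2 / (32 * B ^+ 2))).
Proof.
move=> L0 heps.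
pose bad (h : {ffun 'I_L -> J}) := [set x | eps < `|(sample_avg phi h - p).[x]|].
pose t : R := expR (- (L%:R * eps ^+ 2 / (32 * B ^+ 2))).
have mbad h : measurable (bad h) by exact: measurable_poly_gt.
have hb h : bdmeas a b \1_(bad h) by exact: bdmeas_indic.
(* At a fixed x, the values of the atoms are bounded by B and average to p(x), so the sampling tail
   bounds the probability that x is bad. *)
have pt x : x \in `[a, b] ->
    \sum_(h : {ffun 'I_L -> J}) prod_weight w h * \1_(bad h) x <= 2 * t.
  move=> xab.
  apply: le_trans (sampling_tail_norm L0 w0 w1 B0 heps (fun j => @phiB j x xab)).
  apply: ler_sum => h _; rewrite ler_wpM2l ?prod_weight_ge0 //.
  rewrite indicE.
  have [/set_mem|_] := boolP (x \in bad h); last by [].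
  rewrite /bad /= /sample_avg /p hornerD hornerN hornerZ !horner_sum.
  rewrite [X in _ < `|X - _|]mulrC.
  by under [X in _ < `|_ - X|]eq_bigr do rewrite hornerZ; move=> ->.
suff [h hh] : exists h : {ffun 'I_L -> J},
    W \1_(bad h) + empirical xs (bad h) <= 4 * t by exists h.
apply: contrapT => /forallNP no.
have {}no h : 4 * t < W \1_(bad h) + empirical xs (bad h).
  by rewrite ltNge; apply/negP; exact: no.
(* Averaging over h commutes with integration against nu and with the empirical mean; each
   contributes at most 2 t. If every h exceeded 4 t, so would this average, some tuple having
   positive weight. *)
have tot : \sum_(h : {ffun 'I_L -> J})
    prod_weight w h * (W \1_(bad h) + empirical xs (bad h)) <= 4 * t.
  under eq_bigr do rewrite mulrDr.
  rewrite big_split /=.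
  have -> : 4 * t = 2 * t + 2 * t by ring.
  apply: lerD.
    rewrite (eq_bigr (fun h => W (fun x => prod_weight w h * \1_(bad h) x)));
      last by move=> h _; rewrite /W wintZ.
    rewrite /W -wint_sum //; last by move=> h; exact: bdmeasZ.
    rewrite -[leRHS](wint_cst dnu); apply: le_wint => //.
      by apply: bdmeas_sum => h; exact: bdmeasZ.
    exact: bdmeas_cst.
  under eq_bigr do rewrite /empirical mulrA mulr_sumr.
  rewrite -mulr_suml exchange_big /= ler_pdivrMr ?ltr0n //.
  apply: (@le_trans _ _ (\sum_(i < m) (2 * t))).
    by apply: ler_sum => i _; exact: pt.
  by rewrite sumr_const card_ord mulr_natr.
have : 4 * t < 4 * t; last by rewrite ltxx.
apply: lt_le_trans tot.
have -> : 4 * t = \sum_(h : {ffun 'I_L -> J}) prod_weight w h * (4 * t).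
  by rewrite -mulr_suml sum_prod_weight // mul1r.
have [h0 h0pos] : exists h0 : {ffun 'I_L -> J}, 0 < prod_weight w h0.
  apply: contrapT => /forallNP nopos.
  have := sum_prod_weight L w1; rewrite big1; last first.
    move=> h _; apply/eqP; rewrite eq_le prod_weight_ge0 // andbT leNgt.
    by apply/negP; exact: nopos.
  by move/eqP; rewrite eq_sym oner_eq0.
rewrite (bigD1 h0) //= [ltRHS](bigD1 h0) //=; apply: ltr_leD.
  by rewrite ltr_pM2l //; exact: no.
by apply: ler_sum => h _; rewrite ler_wpM2l ?prod_weight_ge0 // ltW.
Qed.

(** Outside the bad set the average is within tau/4 of p. So |p| >= tau forces the average to be at
    least 3/4 tau in absolute value, which in turn forces |p| >= tau/2. The bad set is charged once
    to nu and once to the empirical measure, at total cost [delta]. *)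
Lemma level_comparison L (tau e delta : R) : (0 < L)%N -> 0 <= tau <= 16 * B ->
  4 * expR (- (L%:R * (tau / 4) ^+ 2 / (32 * B ^+ 2))) <= delta ->
  (forall h : {ffun 'I_L -> J},
     let S := [set x | 3 / 4 * tau <= `|(sample_avg phi h).[x]|] in
     W \1_S / 2 - e <= empirical xs S) ->
  W \1_[set x | tau <= `|p.[x]|] / 2 - e - delta <=
    empirical xs [set x | tau / 2 <= `|p.[x]|].
Proof.
move=> L0 /andP[tau0 tauB] hdelta good.
have /(exists_sample_avg L0)[h] : 0 <= tau / 4 <= 4 * B by apply/andP; split; lra.
set bad := [set x | _] => /= hbad.
have := good h; set S := [set x | _] => /= hS.
have h1 : W \1_[set x | tau <= `|p.[x]|] <= W \1_S + W \1_bad.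
  apply: le_wint_indic; [exact: measurable_poly_ge|exact: measurable_poly_ge|
    exact: measurable_poly_gt|].
  move=> x /= hx.
  have [hlt|hge] := ltP (tau / 4) `|(sample_avg phi h - p).[x]|; first by right.
  left; rewrite /S /=; move: hge; rewrite hornerD hornerN.
  have := ler_normD ((sample_avg phi h).[x]) (p.[x] - (sample_avg phi h).[x]).
  rewrite addrC subrK distrC; lra.
have h2 : empirical xs S <=
    empirical xs [set x | tau / 2 <= `|p.[x]|] + empirical xs bad.
  apply: le_empirical => x; rewrite /S /= => hx.
  have [hlt|hge] := ltP (tau / 4) `|(sample_avg phi h - p).[x]|; first by right.
  left; move: hge; rewrite hornerD hornerN /=.
  have := ler_normD (p.[x]) ((sample_avg phi h).[x] - p.[x]).
  rewrite addrC subrK; lra.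
have w0bad : 0 <= W \1_bad.
  apply: (wint_ge0 dnu); first by apply: bdmeas_indic; exact: measurable_poly_gt.
  by move=> x _; rewrite indicE.
lra.
Qed.

End level_comparison.

(** The unit mass forces the weighted sum of the nu-measures of the levels to be at least 1. Halving
    it and subtracting the errors leaves 1/4 for the empirical levels, whose weighted sum is at most
    22 times the empirical mean of p^2; and 4 * 22 <= 100. *)
Lemma empirical_sqr_ge (R : realType) (a b : R) (nu : R -> R) (p : {poly R})
    (m : nat) (xs : 'I_m -> R) (n : nat) (e : 'I_n -> R) :
  a < b -> is_density a b nu -> (0 < m)%N ->
  1 <= wint a b nu (fun x => p.[x] ^+ 2) ->
  (forall x, x \in `[a, b] -> `|p.[x]| < 2 ^+ n / 2) ->
  (forall i : 'I_n, wint a b nu \1_[set x | 2 ^+ i / 2 <= `|p.[x]|] / 2 - e i <=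
     empirical xs [set x | 2 ^+ i / 2 / 2 <= `|p.[x]|]) ->
  \sum_(i < n) 4 ^+ i * e i <= 1 / 4 ->
  m%:R <= 100 * \sum_i p.[xs i] ^+ 2.
Proof.
move=> ab dnu m0 p1 pB hlev he.
pose U (i : 'I_n) := [set x | 2 ^+ i / 2 <= `|p.[x]|].
pose V (i : 'I_n) := [set x | 2 ^+ i / 2 / 2 <= `|p.[x]|].
have mU i : measurable (U i) by exact: measurable_poly_ge.
have bU i : bdmeas a b \1_(U i) by exact: bdmeas_indic.
have hW : 1 <= \sum_(i < n) 4 ^+ i * wint a b nu \1_(U i).
  have : wint a b nu (fun x => p.[x] ^+ 2) <=
      1 / 4 + \sum_(i < n) (3 / 4 * 4 ^+ i) * wint a b nu \1_(U i).
    rewrite -[X in X + _](wint_cst dnu).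
    rewrite (eq_bigr (fun i : 'I_n =>
      wint a b nu (fun x => (3 / 4 * 4 ^+ i) * \1_(U i) x))); last first.
      by move=> i _; rewrite wintZ.
    have bs : bdmeas a b (fun x => \sum_(i < n) 3 / 4 * 4 ^+ i * \1_(U i) x).
      by apply: bdmeas_sum => i; exact: bdmeasZ.
    rewrite -wint_sum // -?wintD //; [|exact: bdmeas_cst|by move=> i; exact: bdmeasZ].
    apply: le_wint => //.
    - by apply: bdmeas_sqr; exact: bdmeas_poly.
    - by apply: bdmeasD => //; exact: bdmeas_cst.
    move=> x xab; apply: le_trans (sqr_le_dyadic (pB _ xab)) _.
    rewrite lerD2l; apply: ler_sum => i _.
    rewrite ler_wpM2l ?mulr_ge0 ?exprn_ge0 // indicE /U.
    case: (boolP (2 ^+ i / 2 <= `|p.[x]|)%R) => h //.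
    by rewrite mem_set.
  under eq_bigr do rewrite -mulrA.
  rewrite -mulr_sumr.
  lra.
have hV : \sum_(i < n) 4 ^+ i * empirical xs (V i) <=
    22 * (\sum_i p.[xs i] ^+ 2) / m%:R.
  rewrite /empirical; under eq_bigr do rewrite mulrA mulr_sumr.
  rewrite -mulr_suml ler_wpM2r ?invr_ge0 // exchange_big /= mulr_sumr.
  apply: ler_sum => k _; apply: le_trans (dyadic_le_sqr n _).
  apply: ler_sum => i _; rewrite ler_wpM2l ?exprn_ge0 // indicE /V.
  have [/set_mem /=|//] := boolP (xs k \in _).
  have -> : 2 ^+ i / 2 / 2 = 2 ^+ i / 4 :> R by field.
  by move=> ->.
have hsum : \sum_(i < n) 4 ^+ i * wint a b nu \1_(U i) / 2
    - \sum_(i < n) 4 ^+ i * e i <= \sum_(i < n) 4 ^+ i * empirical xs (V i).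
  rewrite -sumrB; apply: ler_sum => i _; rewrite -mulrA -mulrBr.
  by rewrite ler_wpM2l ?exprn_ge0 //; exact: hlev.
rewrite -mulr_suml in hsum.
have : 1 / 4 <= 22 * (\sum_i p.[xs i] ^+ 2) / m%:R by lra.
rewrite ler_pdivlMr ?ltr0n // => h.
have : 0 <= \sum_i p.[xs i] ^+ 2 by apply: sumr_ge0 => i _; exact: sqr_ge0.
lra.
Qed.

Lemma wint_lincomb_sqr (R : realType) (a b : R) (nu : R -> R) N
    (psi : 'I_N -> {poly R}) (v : 'cV[R]_N) :
  a < b -> is_density a b nu -> orthonormal_wrt a b nu psi ->
  wint a b nu (fun x => (lincomb psi v).[x] ^+ 2) = \sum_(j < N) v j 0 ^+ 2.
Proof.
move=> ab dnu orth.
have bp j k : bdmeas a b (fun x => (psi j).[x] * (psi k).[x]).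
  by apply: bdmeasM; exact: bdmeas_poly.
have -> : (fun x => (lincomb psi v).[x] ^+ 2) =
    (fun x => \sum_j \sum_k (v j 0 * v k 0) * ((psi j).[x] * (psi k).[x])).
  apply/funext => x; rewrite /lincomb horner_sum expr2 mulr_suml.
  apply: eq_bigr => j _; rewrite mulr_sumr; apply: eq_bigr => k _.
  by rewrite !hornerZ; ring.
rewrite wint_sum //; last by move=> j; apply: bdmeas_sum => k; exact: bdmeasZ.
apply: eq_bigr => j _; rewrite wint_sum //; last by move=> k; exact: bdmeasZ.
rewrite (bigD1 j) //= wintZ // /wint orth eqxx mulr1 big1 ?addr0 // => k kj.
by rewrite -/(wint _ _ _ _) wintZ // /wint orth eq_sym (negbTE kj) mulr0.
Qed.

(** This is where the weights dominate the basis: a bound on the weighted norm caps the sup norm,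
    hence the number of dyadic levels needed. *)
Lemma le_lincomb_wl1norm (R : realType) (a b : R) N
    (psi : 'I_N -> {poly R}) (omega v : 'cV[R]_N) x :
  (forall j, `|(psi j).[x]| <= omega j 0) ->
  `|(lincomb psi v).[x]| <= wl1norm omega v.
Proof.
move=> hpsi; rewrite /lincomb horner_sum.
apply: le_trans (ler_norm_sum _ _ _) _; apply: ler_sum => j _.
by rewrite hornerZ normrM mulrC ler_wpM2r.
Qed.

(** * The lower bound on sampled squares, uniform over the cone *)

Section uniform_lower_bound.
Variables (R : realType) (a b : R) (nu : R -> R).
Hypotheses (ab : a < b) (dnu : is_density a b nu).
Variables (d : measure_display) (T : measurableType d) (P : probability T R).
Variables (m : nat) (X : 'I_m -> {RV P >-> R}).
Hypotheses (m0 : (0 < m)%N) (indep : mutually_independent X).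
Hypothesis dX : forall i, has_density a b nu (X i).

(** A density on [a, b] excludes other values only almost surely, while the bounds on the basis hold
    only on [a, b]; one null event is removed once and for all. *)
Lemma ae_in_itv : exists E : set T, [/\ measurable E, P E = 0%E &
  forall t, ~ E t -> forall i, X i t \in `[a, b]].
Proof.
have mX i (S : set R) : measurable S -> measurable (X i @^-1` S).
  exact: measurable_funPTI.
have mE i : measurable (X i @^-1` (~` `[a, b])).
  by apply: mX; apply: measurableC; exact: measurable_itv.
exists (\big[setU/set0]_i (X i @^-1` (~` `[a, b]))); split.
- exact: bigsetU_measurable.
- apply/eqP; rewrite eq_le measure_ge0 andbT.
  apply: le_trans (measure_bigsetU_le _ _ _ mE) _.
  rewrite big1 // => i _; rewrite (has_density_wint dnu (dX i)); last first.
    by apply: measurableC; exact: measurable_itv.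
  congr EFin; rewrite -(wint_cst dnu 0); apply: eq_Rintegral => x xab.
  by rewrite indicE in_setC xab.
- move=> t ht i; apply: contrapT => hi; apply: ht.
  by rewrite -bigcup_seq; exists i; rewrite /= ?mem_index_enum.
Qed.

(** A union bound of [count_lower_tail] over all tuples [h]. The exceptional event depends on the
    atoms only, not on the polynomial being approximated, which makes the result uniform. *)
Lemma level_event (J : finType) (phi : J -> {poly R}) L (c e : R) :
  exists E : set T, [/\ measurable E,
    (P E <= (#|J|%:R ^+ L * expR (- (m%:R * e)))%:E)%E &
    forall t, ~ E t -> forall h : {ffun 'I_L -> J},
      let S := [set x | c <= `|(sample_avg phi h).[x]|] in
      wint a b nu \1_S / 2 - e <= empirical (fun i => X i t) S].
Proof.
pose S (h : {ffun 'I_L -> J}) := [set x | c <= `|(sample_avg phi h).[x]|].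
have mS h : measurable (S h) by exact: measurable_poly_ge.
have q01 h : 0 <= wint a b nu \1_(S h) <= 1.
  have bS : bdmeas a b \1_(S h) by exact: bdmeas_indic.
  apply/andP; split; first by apply: (wint_ge0 dnu) => // x _; rewrite indicE.
  rewrite -[leRHS](wint_cst dnu); apply: le_wint => //; exact: bdmeas_cst.
have /choice[E hE] : forall h, exists E : set T, [/\ measurable E,
    (P E <= (expR (- (m%:R * e)))%:E)%E &
    forall t, \sum_i \1_(S h) (X i t) <= m%:R * (wint a b nu \1_(S h) / 2 - e) ->
      E t].
  move=> h; apply: count_lower_tail => // i.
  exact: has_density_wint.
have mE h : measurable (E h) by case: (hE h).
exists (\big[setU/set0]_(h : {ffun 'I_L -> J}) E h); split.
- exact: bigsetU_measurable.
- apply: le_trans (measure_bigsetU_le _ _ _ mE) _.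
  apply: (@le_trans _ _
    (\sum_(h : {ffun 'I_L -> J}) (expR (- (m%:R * e)))%:E)%E).
    by apply: lee_sum => h _; case: (hE h).
  by rewrite sumEFin sumr_const card_ffun card_ord -natrX -(mulr_natl (expR _)).
- move=> t ht h /=; rewrite leNgt; apply/negP => hlt; apply: ht.
  rewrite -bigcup_seq; exists h; first by rewrite /= mem_index_enum.
  case: (hE h) => _ _; apply; move: hlt; rewrite /empirical -/(S h).
  by rewrite ltr_pdivrMr ?ltr0n // mulrC => /ltW.
Qed.

Variables (N : nat) (psi : 'I_N.+1 -> {poly R}) (omega : 'cV[R]_N.+1).
Hypothesis orth : orthonormal_wrt a b nu psi.
Hypothesis omega0 : forall j, 0 < omega j 0.
Hypothesis psiB : forall j x, x \in `[a, b] -> `|(psi j).[x]| <= omega j 0.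
Variable B : R.
Hypothesis B0 : 0 < B.

(** The boolean carries the sign. The coefficient vectors of the atoms are the vertices of the
    weighted l1 ball of radius [B]. *)
Definition atom (jb : 'I_N.+1 * bool) : {poly R} :=
  ((-1) ^+ jb.2 * B / omega jb.1 0) *: psi jb.1.

Lemma atom_bounded jb x : x \in `[a, b] -> `|(atom jb).[x]| <= B.
Proof.
move=> xab; rewrite /atom hornerZ !normrM normrX normrN1 expr1n mul1r normfV.
rewrite (gtr0_norm B0) (gtr0_norm (omega0 _)).
by rewrite mulrAC ler_pdivrMr // ler_pM2l // psiB.
Qed.

Lemma lincomb_atoms (u : 'cV[R]_N.+1) : wl1norm omega u <= B ->
  exists w : 'I_N.+1 * bool -> R, [/\ forall jb, 0 <= w jb,
    \sum_jb w jb = 1 & lincomb psi u = \sum_jb w jb *: atom jb].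
Proof.
move=> uB.
(* The mass left over when [u] is inside the ball is spread evenly over the N + 1 pairs of opposite
   atoms, where it cancels. The remaining weights are the positive and negative parts of omega_j u_j
   / B. *)
pose sl := (1 - wl1norm omega u / B) / N.+1%:R.
pose w (jb : 'I_N.+1 * bool) : R :=
  ((omega jb.1 0 * `|u jb.1 0| + (-1) ^+ jb.2 * (omega jb.1 0 * u jb.1 0)) / B
    + sl) / 2.
have sl0 : 0 <= sl.
  by rewrite /sl divr_ge0 // subr_ge0 ler_pdivrMr // mul1r.
have sum2 (V : nmodType) (F : 'I_N.+1 * bool -> V) :
    \sum_jb F jb = \sum_j (F (j, true) + F (j, false)).
  rewrite (eq_bigr (fun jb => F (jb.1, jb.2))); last by case.
  rewrite -(pair_bigA _ (fun j c => F (j, c))) /=.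
  by apply: eq_bigr => j _; rewrite big_bool.
exists w; split.
- move=> [j c]; rewrite /w /= divr_ge0 // addr_ge0 // divr_ge0 //; last exact: ltW.
  have : - (omega j 0 * `|u j 0|) <= omega j 0 * u j 0 <= omega j 0 * `|u j 0|.
    by rewrite -mulrN !ler_pM2l // -ler_norml.
  by case: c => /andP[]; rewrite ?expr1 ?expr0; lra.
- rewrite sum2 (eq_bigr (fun j => omega j 0 * `|u j 0| / B + sl)); last first.
    by move=> j _; rewrite /w /= expr1 expr0; field; rewrite gt_eqF.
  rewrite big_split /= -mulr_suml -/(wl1norm omega u) sumr_const card_ord.
  by rewrite -mulr_natr /sl divfK ?pnatr_eq0 // addrC subrK.
- rewrite sum2; apply: eq_bigr => j _.
  rewrite /atom /w /= expr1 expr0 !scalerA -scalerDl; congr (_ *: _).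
  by field; rewrite !gt_eqF.
Qed.

(** By homogeneity v is normalized to u = v / |v|_2, whose polynomial is a convex combination of
    atoms. Since it is bounded by B < 2^n / 2, the first n levels capture it. *)
Lemma uniform_lower_bound n (L : nat -> nat) (e : nat -> R) :
  (forall i, (i < n)%N -> (0 < L i)%N) ->
  B < 2 ^+ n / 2 ->
  (forall i, (i < n)%N -> 2 ^+ i / 2 <= 16 * B) ->
  (forall i, (i < n)%N ->
     4 * expR (- ((L i)%:R * (2 ^+ i / 2 / 4) ^+ 2 / (32 * B ^+ 2))) <= e i) ->
  \sum_(i < n) 4 ^+ i * e i <= 1 / 8 ->
  exists E : set T, [/\ measurable E,
    (P E <= (\sum_(i < n)
      (2 * N.+1)%:R ^+ L i * expR (- (m%:R * e i)))%:E)%E &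
    forall t, ~ E t -> (forall i, X i t \in `[a, b]) /\
      forall v : 'cV[R]_N.+1, wl1norm omega v <= B * l2norm v ->
        m%:R * l2norm v ^+ 2 <= 100 * \sum_i (lincomb psi v).[X i t] ^+ 2].
Proof.
move=> L0 Bn tauB eL sume.
have [E0 [mE0 PE0 hE0]] := ae_in_itv.
have /choice[E hE] : forall i : nat, exists E : set T, [/\ measurable E,
    (P E <= ((2 * N.+1)%:R ^+ L i * expR (- (m%:R * e i)))%:E)%E &
    forall t, ~ E t -> forall h : {ffun 'I_(L i) -> 'I_N.+1 * bool},
      let S := [set x | 3 / 4 * (2 ^+ i / 2) <= `|(sample_avg atom h).[x]|] in
      wint a b nu \1_S / 2 - e i <= empirical (fun i => X i t) S].
  move=> i; have := level_event atom (L i) (3 / 4 * (2 ^+ i / 2)) (e i).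
  by rewrite card_prod card_ord card_bool mulnC.
have mE i : measurable (E i) by case: (hE i).
exists (E0 `|` \big[setU/set0]_(i < n) E i); split.
- by apply: measurableU => //; exact: bigsetU_measurable.
- have : (P (E0 `|` \big[setU/set0]_(i < n) E i) <=
      P E0 + P (\big[setU/set0]_(i < n) E i))%E.
    by apply: measureU2 => //; exact: bigsetU_measurable.
  rewrite PE0 add0e => /le_trans; apply.
  apply: le_trans (measure_bigsetU_le _ _ _ _) _ => //.
  by rewrite -sumEFin; apply: lee_sum => i _; case: (hE i).
move=> t /not_orP[/hE0 tab tE]; split => // v hv.
have {}tE i : (i < n)%N -> ~ E i t.
  move=> ilt Eit; apply: tE; rewrite -bigcup_mkord.
  by exists i.
have l2v : l2norm v ^+ 2 = \sum_j v j 0 ^+ 2.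
  by rewrite sqr_sqrtr //; apply: sumr_ge0 => j _; exact: sqr_ge0.
have sum0 (p : {poly R}) : 0 <= \sum_i p.[X i t] ^+ 2.
  by apply: sumr_ge0 => i _; exact: sqr_ge0.
have [v0|v0] := eqVneq (l2norm v) 0.
  by rewrite v0 expr0n mulr0 mulr_ge0.
have vpos : 0 < l2norm v by rewrite lt_neqAle eq_sym v0 sqrtr_ge0.
pose u := (l2norm v)^-1 *: v.
have uB : wl1norm omega u <= B.
  rewrite /wl1norm (eq_bigr (fun j => (omega j 0 * `|v j 0|) / l2norm v)).
    by rewrite -mulr_suml ler_pdivrMr.
  by move=> j _; rewrite mxE normrM normfV (gtr0_norm vpos); ring.
have lu : lincomb psi u = (l2norm v)^-1 *: lincomb psi v.
  rewrite /lincomb scaler_sumr; apply: eq_bigr => j _.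
  by rewrite mxE scalerA.
have [w [w0 w1 hw]] := lincomb_atoms uB.
have key : m%:R <= 100 * \sum_i (lincomb psi u).[X i t] ^+ 2.
  (* The error is doubled: [e i] pays once for the Chernoff bound and once for the approximation by
     averages, so the budget 1/8 becomes 1/4. *)
  apply: (@empirical_sqr_ge _ a b nu (lincomb psi u) m (fun i => X i t) n
    (fun i => 2 * e i)) => //.
  - rewrite wint_lincomb_sqr //.
    rewrite (eq_bigr (fun j => v j 0 ^+ 2 / l2norm v ^+ 2)).
      by rewrite -mulr_suml -l2v divff // expf_neq0.
    by move=> j _; rewrite mxE exprMn exprVn mulrC.
  - move=> x xab; apply: le_lt_trans Bn; apply: le_trans uB.
    by apply: le_lincomb_wl1norm => // j; exact: psiB.
  - move=> i; have ilt := ltn_ord i.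
    case: (hE i) => _ _ /(_ _ (tE _ ilt)) hlev.
    have tau : 0 <= (2 : R) ^+ i / 2 <= 16 * B.
      by rewrite tauB // divr_ge0 ?exprn_ge0.
    have := level_comparison dnu w0 w1 B0 (fun jb x => @atom_bounded jb x)
      m0 tab (L0 _ ilt) tau (eL _ ilt) hlev.
    by rewrite -hw; apply: le_trans; lra.
  - under eq_bigr do rewrite mulrCA.
    by rewrite -mulr_sumr; lra.
have : m%:R * l2norm v ^+ 2 <=
    (100 * \sum_i (lincomb psi u).[X i t] ^+ 2) * l2norm v ^+ 2.
  by rewrite ler_wpM2r ?sqr_ge0.
congr (_ <= _); rewrite -mulrA mulr_suml; congr (_ * _); apply: eq_bigr => i _.
by rewrite lu hornerZ -exprMn mulrAC mulVf // mul1r.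
Qed.

End uniform_lower_bound.

(** * Choice of the number of levels, the net sizes and the tolerances *)

Lemma ln2_ge_half (R : realType) : 1 / 2 <= ln 2 :> R.
Proof.
rewrite -ler_expR lnK ?posrE //.
apply: le_trans (expR_le_quad (lexx _)) _.
by rewrite expr2; lra.
Qed.

Lemma sqr_pow2 (R : realType) i : (2 ^+ i) ^+ 2 = 4 ^+ i :> R.
Proof. by rewrite -exprM mulnC exprM; congr (_ ^+ _); rewrite expr2; lra. Qed.

(** Take n - 1 to be the integer part of log_4 (64 s). The condition 64 s < 4^n is the square of 4
    sqrt(s) < 2^n / 2, and n <= 9 ln s follows from 4^n <= 256 s <= s^9 and ln 4 >= 1. *)
Lemma dyadic_depth (R : realType) (s : nat) : (2 <= s)%N ->
  exists n : nat, [/\ (forall i, (i < n)%N -> (4 : R) ^+ i <= 64 * s%:R),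
    64 * s%:R < (4 : R) ^+ n, (4 : R) ^+ n <= 256 * s%:R &
    n%:R <= 9 * ln s%:R :> R].
Proof.
move=> s2; have s0 : (0 < s)%N by exact: leq_trans s2.
pose k := trunc_log 4 (64 * s).
have k1 : (4 ^ k <= 64 * s)%N by apply: trunc_logP; rewrite // muln_gt0.
have k2 : (64 * s < 4 ^ k.+1)%N by exact: trunc_log_ltn.
have k3 : (4 ^ k.+1 <= 256 * s)%N.
  by rewrite expnS (leq_trans (leq_mul (leqnn 4) k1)) // mulnA.
have n4 j : (4 : R) ^+ j = (4 ^ j)%:R by rewrite natrX.
exists k.+1; split.
- move=> i ik; rewrite n4 -natrM ler_nat; apply: leq_trans k1.
  by rewrite leq_exp2l.
- by rewrite n4 -natrM ltr_nat.
- by rewrite n4 -natrM ler_nat.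
have s9 : (256 * s <= s ^ 9)%N.
  have h : (2 ^ 8 <= s ^ 8)%N by rewrite leq_exp2r.
  by rewrite (expnSr s 8) leq_mul2r [X in _ || X](leq_trans _ h) ?orbT.
have : k.+1%:R * ln 4 <= 9 * ln s%:R :> R.
  rewrite !(mulr_natl (ln _)) -!lnXn ?ltr0n //.
  rewrite ler_ln ?posrE ?exprn_gt0 ?ltr0n //.
  by rewrite n4 -natrX ler_nat (leq_trans k3).
apply: le_trans; rewrite -[leLHS]mulr1 ler_wpM2l //.
have -> : 4 = 2 ^+ 2 :> R by rewrite expr2; lra.
by rewrite lnXn // mulr2n; have := ln2_ge_half R; lra.
Qed.

Section parameters.
Variables (R : realType) (N s : nat) (l H D : R).
Hypotheses (N0 : (0 < N)%N) (s2 : (2 <= s)%N).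
Hypotheses (lE : l = ln s%:R) (HE : H = ln N.+1%:R) (DE : D = 64 * (32 * 16)).

Let s0 : 0 < s%:R :> R. Proof. by rewrite ltr0n (leq_trans _ s2). Qed.

Let l_ge : 1 / 2 <= l.
Proof.
rewrite lE; apply: le_trans (ln2_ge_half R) _.
by rewrite ler_ln ?posrE // ler_nat.
Qed.

Let H_ge : 1 / 2 <= H.
Proof.
rewrite HE; apply: le_trans (ln2_ge_half R) _.
by rewrite ler_ln ?posrE ?ltr0n // ler_nat ltnS.
Qed.

(* The term 1/s yields the failure probability when i is close to n; the term
   1/(l 4^i) pays for the union bound over the net at level i. *)
Definition net_tolerance (i : nat) : R := (s%:R^-1 + (l * 4 ^+ i)^-1) / 800.

(** The sampling exponent at level i is L 4^i / (D s), and this size makes it at least 16 ln s. The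
    successor rounds up and keeps the size positive. *)
Definition net_size (i : nat) : nat := (Num.truncn (16 * D * l * s%:R / 4 ^+ i)).+1.

Let p4 i : 0 < (4 : R) ^+ i. Proof. by rewrite exprn_gt0. Qed.

Lemma sum_net_tolerance n : (4 : R) ^+ n <= 256 * s%:R -> n%:R <= 9 * l ->
  \sum_(i < n) 4 ^+ i * net_tolerance i <= 1 / 8.
Proof.
move=> hn nl; have l0 : 0 < l by apply: lt_le_trans l_ge.
(* The two parts of the tolerance contribute at most 256/3 and 9 over 800, together below
   100/800. *)
rewrite (eq_bigr (fun i : 'I_n => 4 ^+ i * (s%:R^-1 / 800) + (l^-1 / 800))).
  rewrite big_split /= -mulr_suml sum_pow4 sumr_const card_ord -(mulr_natl (_ / _)).
  have : 4 ^+ n / s%:R <= 256 :> R by rewrite ler_pdivrMr.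
  have : n%:R / l <= 9 :> R by rewrite ler_pdivrMr.
  have : 0 <= s%:R^-1 :> R by rewrite invr_ge0.
  by lra.
by move=> i _; rewrite /net_tolerance; field; rewrite !gt_eqF.
Qed.

Lemma net_size_precision i :
  4 * expR (- ((net_size i)%:R * (2 ^+ i / 2 / 4) ^+ 2 /
    (32 * (4 * Num.sqrt s%:R) ^+ 2))) <= net_tolerance i.
Proof.
have l0 : 0 < l by apply: lt_le_trans l_ge.
apply: (@le_trans _ _ (s%:R^-1 / 800)); last first.
  rewrite /net_tolerance mulrDl lerDl.
  apply: divr_ge0; last exact: ler0n.
  by rewrite invr_ge0 ltW // mulr_gt0.
have hL : 16 * D * l * s%:R / 4 ^+ i <= (net_size i)%:R by rewrite ltW ?truncnS_gt.
apply: (@le_trans _ _ (4 * expR (- (16 * l)))).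
  rewrite ler_pM2l // ler_expR lerN2.
  rewrite !exprMn sqr_pow2 (sqr_sqrtr (ltW s0)).
  (* In [D], the 64 comes from (2^i / 8)^2 = 4^i / 64 and the 32 * 16 from the denominator 32 (4
     sqrt(s))^2. *)
  have -> : (net_size i)%:R * (4 ^+ i * 2^-1 ^+ 2 * 4^-1 ^+ 2) /
      (32 * (4 ^+ 2 * s%:R)) = (net_size i)%:R * 4 ^+ i / (D * s%:R) :> R.
    by rewrite DE; field; rewrite gt_eqF.
  rewrite ler_pdivlMr; last by rewrite mulr_gt0 // DE !mulr_gt0.
  by move: hL; rewrite ler_pdivrMr //; lra.
rewrite expRN expRM_natl lE lnK ?posrE //.
(* The goal is now 4 s^-16 <= s^-1 / 800, that is 3200 <= s^15, which 2^15 already satisfies. *)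
have s15 : 3200 <= s%:R ^+ 15 :> R.
  rewrite -natrX ler_nat; apply: (@leq_trans (2 ^ 15)); first by [].
  by rewrite leq_exp2r.
have : (s%:R ^+ 15)^-1 <= 3200^-1 :> R by rewrite lef_pV2 ?posrE ?(exprn_gt0 _ s0) ?ltr0n.
have sV : 0 <= s%:R^-1 :> R by rewrite invr_ge0.
move=> /(ler_wpM2l sV); rewrite exprS invfM; lra.
Qed.

(** With z = l s / 4^i, the net costs at most 2 K z H in the exponent, while the bound on m gives m
    e_i >= 4 K l^3 H + 4 K l z H. As l >= 1/2 the second summand absorbs the net; as K >= 128 the
    first leaves 512 l^3 H. The number of levels costs at most 9 l <= 72 l^3 H and the target is at
    most 27 l^3 H. *)
Lemma net_failure (m n : nat) :
  (forall i, (i < n)%N -> (4 : R) ^+ i <= 64 * s%:R) -> n%:R <= 9 * l ->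
  3200 * (16 * D + 128) * s%:R * l ^+ 3 * H <= m%:R ->
  \sum_(i < n) (2 * N.+1)%:R ^+ net_size i * expR (- (m%:R * net_tolerance i))
    <= N.+1%:R `^ (- ln (3 * s%:R) ^+ 3).
Proof.
move=> hn nl hm; have lg := l_ge; have Hg := H_ge.
have l0 : 0 < l by apply: lt_le_trans l_ge.
have H0 : 0 < H by apply: lt_le_trans H_ge.
pose K := 16 * D + 128.
have D0 : 0 <= D by rewrite DE; lra.
have K128 : 128 <= K by rewrite /K DE; lra.
have l3 : 0 < l ^+ 3 by rewrite exprn_gt0.
have l3H0 : 0 < l ^+ 3 * H by rewrite mulr_gt0.
have term i : (i < n)%N ->
    (2 * N.+1)%:R ^+ net_size i * expR (- (m%:R * net_tolerance i)) <=
    expR (- (512 * (l ^+ 3 * H))).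
  move=> ilt; have h4 := hn _ ilt.
  have hL : (net_size i)%:R <= K * l * s%:R / 4 ^+ i.
    apply: (@le_trans _ _ (16 * D * l * s%:R / 4 ^+ i + 1)).
      rewrite /net_size -natr1 lerD2r truncn_le //.
      by rewrite !mulr_ge0 ?invr_ge0 // ltW.
    (* The unit added by rounding is absorbed into 128 l s / 4^i, as 4^i <= 64 s. *)
    have : 1 <= 128 * l * s%:R / 4 ^+ i.
      rewrite ler_pdivlMr // mul1r; apply: le_trans h4 _.
      by rewrite ler_pM2r //; lra.
    by rewrite /K; lra.
  have h1 : (2 * N.+1)%:R ^+ net_size i <= expR ((net_size i)%:R * (2 * H)).
    rewrite expRM_natl lerXn2r ?nnegrE ?expR_ge0 //.
    rewrite expRM_natl HE lnK ?posrE ?ltr0n // natrM expr2.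
    by rewrite ler_pM2r ?ltr0n // ler_nat ltnS.
  apply: le_trans (ler_wpM2r (expR_ge0 _) h1) _.
  rewrite -expRD ler_expR.
  set z := l * s%:R / 4 ^+ i.
  have z0 : 0 <= z by rewrite /z !mulr_ge0 // ?invr_ge0 ltW.
  have hL' : (net_size i)%:R * (2 * H) <= K * z * (2 * H).
    apply: ler_wpM2r; first by rewrite mulr_ge0 // ltW.
    by rewrite /z !mulrA.
  have he : 3200 * K * s%:R * l ^+ 3 * H * net_tolerance i =
      4 * K * (l ^+ 3 * H) + 4 * K * (l * z * H).
    by rewrite /net_tolerance /z; field; rewrite !gt_eqF.
  have t0 : 0 <= net_tolerance i.
    apply: divr_ge0; last exact: ler0n.
    by rewrite addr_ge0 // invr_ge0 // mulr_ge0 // ltW.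
  have hme : 3200 * K * s%:R * l ^+ 3 * H * net_tolerance i <=
      m%:R * net_tolerance i by rewrite ler_wpM2r.
  have hK : 128 * (l ^+ 3 * H) <= K * (l ^+ 3 * H) by rewrite ler_wpM2r // ltW.
  have hz : K * z * H * (1 / 2) <= K * z * H * l.
    have K0 : 0 <= K by apply: le_trans K128.
    apply: ler_wpM2l lg; apply: mulr_ge0 (ltW H0); exact: mulr_ge0.
  by rewrite he in hme; lra.
apply: (@le_trans _ _ (\sum_(i < n) expR (- (512 * (l ^+ 3 * H))))).
  by apply: ler_sum => i _; exact: term.
rewrite sumr_const card_ord -(mulr_natl (expR _)).
have hn' : n%:R <= expR n%:R :> R.
  by apply: le_trans (expR_ge1Dx _); rewrite lerDr.
apply: le_trans (ler_wpM2r (expR_ge0 _) hn') _.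
rewrite -expRD /powR pnatr_eq0 /= ler_expR -HE.
have hl3 : ln (3 * s%:R) <= 3 * l.
  rewrite lE (mulr_natl (ln _)) -lnXn // ler_ln ?posrE ?mulr_gt0 ?exprn_gt0 //.
  rewrite exprSr ler_pM2r // -natrX ler_nat.
  by apply: (@leq_trans (2 ^ 2)); rewrite // leq_exp2r.
have hl0 : 0 <= ln (3 * s%:R) :> R.
  by rewrite ln_ge0 // -natrM (ler_nat _ 1) muln_gt0 /= (leq_trans _ s2).
have : ln (3 * s%:R) ^+ 3 <= (3 * l) ^+ 3 by rewrite lerXn2r ?nnegrE // mulr_ge0 // ltW.
rewrite exprMn => /(ler_wpM2r (ltW H0)) h27.
have hl : l <= 8 * (l ^+ 3 * H).
  have : 1 / 4 <= l ^+ 2.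
    have : 1 / 2 * (1 / 2) <= l * l by rewrite ler_pM.
    by rewrite expr2; lra.
  move=> l2; have hh : 1 / 4 * (1 / 2) <= l ^+ 2 * H by rewrite ler_pM.
  have := ler_wpM2l (ltW l0) hh; rewrite exprS; lra.
rewrite mulNr; have : 3 ^+ 3 = 27 :> R by rewrite !exprS expr0; lra.
move=> e27; rewrite e27 in h27; lra.
Qed.

End parameters.

(** * The triangle inequality in L2 and deterministic recovery by weighted l1 minimization *)

Lemma le_supnorm (R : realType) (a b : R) (g : R -> R) x :
  a < b -> {within `[a, b], continuous g} -> x \in `[a, b] ->
  `|g x| <= supnorm a b g.
Proof.
move=> ab cg xab; apply: ub_le_sup; last by exists x.
by have [M gM] := continuous_itv_bounded ab cg; exists M => _ [y yab <-]; exact: gM.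
Qed.

Lemma L2norm_sub_le (R : realType) (a b : R) (nu u g : R -> R) :
  is_density a b nu -> bdmeas a b u -> bdmeas a b g ->
  L2norm a b nu (fun x => u x - g x) <= L2norm a b nu u + L2norm a b nu g.
Proof.
move=> dnu bu bg.
have sq h : bdmeas a b h ->
    wint a b nu (fun x => h x ^+ 2) = L2norm a b nu h ^+ 2.
  move=> bh; rewrite /L2norm -/(wint a b nu (fun x => h x ^+ 2)) sqr_sqrtr //.
  by apply: (wint_ge0 dnu); [exact: bdmeas_sqr|move=> x _; exact: sqr_ge0].
apply/ler_addgt0Pr => eps eps0.
(* Both norms are enlarged by eps/2 so that the ratios r / c and c / r below make sense even when a
   norm vanishes. *)
pose c := L2norm a b nu u + eps / 2; pose r := L2norm a b nu g + eps / 2.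
have u0 : 0 <= L2norm a b nu u by exact: sqrtr_ge0.
have g0 : 0 <= L2norm a b nu g by exact: sqrtr_ge0.
have c0 : 0 < c by rewrite /c; lra.
have r0 : 0 < r by rewrite /r; lra.
have -> : L2norm a b nu u + L2norm a b nu g + eps = c + r.
  by rewrite /c /r; lra.
rewrite -(@ler_pXn2r _ 2) ?nnegrE ?sqrtr_ge0 //; last by rewrite addr_ge0 // ltW.
rewrite -sq; last exact: bdmeasB.
(* These coefficients give (u - g)^2 <= k u^2 + k' g^2 pointwise, and they turn the integrated bound
   into exactly (c + r)^2; this replaces the Cauchy-Schwarz inequality. *)
pose k := (1 + r / c) : R; pose k' := (1 + c / r) : R.
have bu2 := bdmeas_sqr bu; have bg2 := bdmeas_sqr bg.
apply: (@le_trans _ _ (wint a b nu (fun x => k * u x ^+ 2 + k' * g x ^+ 2))).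
  apply: le_wint => //.
  - by apply: bdmeas_sqr; exact: bdmeasB.
  - by apply: bdmeasD; exact: bdmeasZ.
  move=> x _; rewrite -subr_ge0.
  have -> : k * u x ^+ 2 + k' * g x ^+ 2 - (u x - g x) ^+ 2 =
      (r * u x + c * g x) ^+ 2 / (c * r).
    by rewrite /k /k'; field; rewrite !gt_eqF.
  by rewrite divr_ge0 ?sqr_ge0 // mulr_ge0 // ltW.
rewrite wintD //; [|exact: bdmeasZ|exact: bdmeasZ].
rewrite !wintZ // !sq //.
have -> : (c + r) ^+ 2 = k * c ^+ 2 + k' * r ^+ 2.
  by rewrite /k /k'; field; rewrite !gt_eqF.
apply: lerD; apply: ler_wpM2l.
- by rewrite addr_ge0 // divr_ge0 // ltW.
- by rewrite lerXn2r ?nnegrE ?(ltW c0) // lerDl divr_ge0 // ltW.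
- by rewrite addr_ge0 // divr_ge0 // ltW.
- by rewrite lerXn2r ?nnegrE ?(ltW r0) // lerDl divr_ge0 // ltW.
Qed.

Lemma sqr_l2norm (R : realType) n (z : 'cV[R]_n) :
  l2norm z ^+ 2 = \sum_(j < n) z j 0 ^+ 2.
Proof. by rewrite sqr_sqrtr //; apply: sumr_ge0 => j _; exact: sqr_ge0. Qed.

(** Cauchy-Schwarz on the support of z, whose squared weights sum to at most s. It is obtained from
    a pointwise arithmetic-geometric mean inequality scaled by sqrt(s) / |v|_2. *)
Lemma wl1_restrict_le (R : realType) n (s : nat) (omega z v : 'cV[R]_n) :
  (0 < s)%N -> wl0norm omega z <= s%:R ->
  \sum_(j < n | z j 0 != 0) omega j 0 * `|v j 0| <= Num.sqrt s%:R * l2norm v.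
Proof.
move=> s0 hz.
have q0 : 0 < Num.sqrt s%:R :> R by rewrite sqrtr_gt0 ltr0n.
have qs : Num.sqrt s%:R ^+ 2 = s%:R :> R by rewrite sqr_sqrtr.
set q := Num.sqrt s%:R in q0 qs *.
have l2v := sqr_l2norm v.
have [v0|v0] := eqVneq (l2norm v) 0.
  rewrite v0 mulr0 big1 // => j _.
  have : v j 0 ^+ 2 <= 0.
    rewrite [leRHS](_ : 0 = \sum_(j < n) v j 0 ^+ 2); last by rewrite -l2v v0 expr0n.
    rewrite (bigD1 j) //= lerDl; apply: sumr_ge0 => i _; exact: sqr_ge0.
  rewrite le_eqVlt ltNge sqr_ge0 orbF sqrf_eq0 => /eqP ->.
  by rewrite normr0 mulr0.
have r0 : 0 < l2norm v by rewrite lt_neqAle eq_sym v0 sqrtr_ge0.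
set r := l2norm v in r0 l2v *.
have pt j : omega j 0 * `|v j 0| <=
    (r / q * omega j 0 ^+ 2 + q / r * v j 0 ^+ 2) / 2.
  rewrite -[v j 0 ^+ 2]real_normK ?num_real // -subr_ge0.
  have -> : (r / q * omega j 0 ^+ 2 + q / r * `|v j 0| ^+ 2) / 2
      - omega j 0 * `|v j 0| =
      (r * omega j 0 - q * `|v j 0|) ^+ 2 / (2 * q * r).
    by field; rewrite !gt_eqF.
  by rewrite divr_ge0 ?sqr_ge0 // mulr_ge0 ?ltW // mulr_gt0.
apply: le_trans (ler_sum _ (fun j _ => pt j)) _.
rewrite -mulr_suml big_split /= -!mulr_sumr.
have h1 : r / q * \sum_(j < n | z j 0 != 0) omega j 0 ^+ 2 <= r * q.
  apply: (@le_trans _ _ (r / q * s%:R)).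
    by rewrite ler_wpM2l // divr_ge0 // ltW.
  by rewrite -qs expr2 mulrA divfK ?gt_eqF.
have h2 : q / r * \sum_(j < n | z j 0 != 0) v j 0 ^+ 2 <= q * r.
  apply: (@le_trans _ _ (q / r * r ^+ 2)).
    apply: ler_wpM2l; first by rewrite divr_ge0 // ltW.
    rewrite l2v [leLHS]big_mkcond /=.
    by apply: ler_sum => j _; case: ifP => // _; exact: sqr_ge0.
  by rewrite expr2 mulrA divfK ?gt_eqF.
lra.
Qed.

(** Compared coordinate by coordinate. On the support of z, use |x_j| <= |c_j| + |c_j - x_j|; off
    it, |x_j - z_j| = |x_j| and |c_j - x_j| <= |c_j| + |x_j|. *)
Lemma wl1_cone (R : realType) n (s : nat) (omega x c z : 'cV[R]_n) :
  (0 < s)%N -> (forall j, 0 <= omega j 0) ->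
  wl1norm omega c <= wl1norm omega x -> wl0norm omega z <= s%:R ->
  wl1norm omega (c - x) <=
    2 * (Num.sqrt s%:R * l2norm (c - x)) + 2 * wl1norm omega (x - z).
Proof.
move=> s0 omega0 hcx hz.
have := wl1_restrict_le (c - x) s0 hz.
suff : wl1norm omega (c - x) <= (wl1norm omega c - wl1norm omega x)
    + 2 * (\sum_(j < n | z j 0 != 0) omega j 0 * `|(c - x) j 0|)
    + 2 * wl1norm omega (x - z) by lra.
rewrite /wl1norm -sumrB !mulr_sumr [X in _ + X + _]big_mkcond -!big_split /=.
apply: ler_sum => j _; rewrite !mxE.
have h1 : `|c j 0 - x j 0| <= `|c j 0| + `|x j 0| by exact: ler_normB.
have h2 : `|x j 0| <= `|c j 0| + `|c j 0 - x j 0|.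
  have := ler_normB (c j 0) (c j 0 - x j 0).
  by rewrite opprB addrC subrK.
have o0 := omega0 j.
have n0 : 0 <= `|x j 0 - z j 0| by [].
case: ifPn => [_|].
  have : 0 <= omega j 0 * (`|c j 0| + `|c j 0 - x j 0| - `|x j 0|
      + 2 * `|x j 0 - z j 0|) by apply: mulr_ge0 => //; lra.
  lra.
rewrite negbK => /eqP ->; rewrite subr0.
have : 0 <= omega j 0 * (`|c j 0| + `|x j 0| - `|c j 0 - x j 0|).
  by apply: mulr_ge0 => //; lra.
lra.
Qed.

Lemma le_mx_norm_col (R : realType) n (omega : 'cV[R]_n.+1) j :
  `|omega j 0| <= `|omega|.
Proof.
rewrite [leRHS]mx_normrE.
exact: (le_bigmax _ (fun ij : 'I_n.+1 * 'I_1 => `|omega ij.1 ij.2|) (j, 0)).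
Qed.

Lemma recovery_of_lower_bound (R : realType) (m n s : nat) (omega : 'cV[R]_n)
    (A : 'M[R]_(m, n)) (y : 'cV[R]_m) (eta Theta : R) (x c : 'cV[R]_n) :
  (0 < m)%N -> (0 < s)%N -> (forall j, 0 <= omega j 0) ->
  1 <= Theta -> 0 <= eta -> (forall i, `|(A *m x - y) i 0| <= eta) ->
  (forall v : 'cV[R]_n, wl1norm omega v <= 4 * Num.sqrt s%:R * l2norm v ->
     m%:R * l2norm v ^+ 2 <= 100 * l2norm (A *m v) ^+ 2) ->
  wl1_minimizer omega A y (Theta * Num.sqrt m%:R * eta) c ->
  l2norm (c - x) <= wsigma s omega x / Num.sqrt s%:R + Theta * 20 * eta.
Proof.
move=> m0 s0 omega0 Theta1 eta0 xfeas lower [cfeas cmin].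
have Theta0 : 0 <= Theta by apply: le_trans Theta1.
have m0' : 0 < m%:R :> R by rewrite ltr0n.
have q0 : 0 < Num.sqrt s%:R :> R by rewrite sqrtr_gt0 ltr0n.
have t0 : 0 <= Theta * Num.sqrt m%:R * eta.
  by rewrite !mulr_ge0 // sqrtr_ge0.
have t2 : (Theta * Num.sqrt m%:R * eta) ^+ 2 = m%:R * (Theta * eta) ^+ 2.
  by rewrite !exprMn sqr_sqrtr //; ring.
have xres : l2norm (A *m x - y) ^+ 2 <= m%:R * (Theta * eta) ^+ 2.
  rewrite sqr_l2norm; apply: (@le_trans _ _ (\sum_(i < m) eta ^+ 2)).
    apply: ler_sum => i _; rewrite -[leLHS]real_normK ?num_real //.
    by rewrite lerXn2r ?nnegrE.
  rewrite sumr_const card_ord -(mulr_natl (eta ^+ 2)) ler_pM2l //.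
  by rewrite lerXn2r ?nnegrE ?mulr_ge0 // ler_peMl.
have hcx : wl1norm omega c <= wl1norm omega x.
  apply: cmin; rewrite -(@ler_pXn2r _ 2) ?nnegrE ?sqrtr_ge0 //.
  by rewrite t2.
have cres : l2norm (A *m c - y) ^+ 2 <= m%:R * (Theta * eta) ^+ 2.
  by rewrite -t2 lerXn2r ?nnegrE ?sqrtr_ge0.
have one z : wl0norm omega z <= s%:R ->
    l2norm (c - x) <= wl1norm omega (x - z) / Num.sqrt s%:R + Theta * 20 * eta.
  move=> hz; have hcone := wl1_cone s0 omega0 hcx hz.
  have e0 : 0 <= Theta * 20 * eta by rewrite !mulr_ge0.
  have [hge|hlt] := leP (Num.sqrt s%:R * l2norm (c - x)) (wl1norm omega (x - z)).
    have : l2norm (c - x) <= wl1norm omega (x - z) / Num.sqrt s%:R.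
      by rewrite ler_pdivlMr // mulrC.
    lra.
  have w0 : 0 <= wl1norm omega (x - z) / Num.sqrt s%:R.
    by rewrite divr_ge0 ?sqrtr_ge0 // sumr_ge0 // => j _; rewrite mulr_ge0.
  suff : l2norm (c - x) <= Theta * 20 * eta by lra.
  have /lower : wl1norm omega (c - x) <= 4 * Num.sqrt s%:R * l2norm (c - x) by lra.
  have Ares : l2norm (A *m (c - x)) ^+ 2 <=
      2 * l2norm (A *m c - y) ^+ 2 + 2 * l2norm (A *m x - y) ^+ 2.
    rewrite !sqr_l2norm !mulr_sumr -big_split /=; apply: ler_sum => i _.
    rewrite mulmxBr !mxE.
    set p := \sum_j A i j * c j 0; set p' := \sum_j A i j * x j 0.
    have := sqr_ge0 ((p - y i 0) + (p' - y i 0)).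
    by rewrite !expr2; lra.
  move=> low; have {}low : m%:R * l2norm (c - x) ^+ 2 <=
      m%:R * (Theta * 20 * eta) ^+ 2.
    apply: (le_trans low).
    (* Two residuals of squared size at most m (Theta eta)^2, each doubled and then multiplied by
       100, give 400 = 20^2. *)
    have -> : m%:R * (Theta * 20 * eta) ^+ 2 = 400 * (m%:R * (Theta * eta) ^+ 2).
      by ring.
    lra.
  rewrite ler_pM2l // in low.
  by rewrite -(@ler_pXn2r _ 2) ?nnegrE ?sqrtr_ge0.
(* The bound holds for every z of weighted sparsity at most s, so it passes to the infimum; z = 0
   shows that the set is nonempty. *)
rewrite -lerBlDr ler_pdivlMr //; apply: lb_le_inf.
  exists (wl1norm omega (x - 0)), 0 => //=.
  by rewrite /wl0norm big1 // => j; rewrite mxE eqxx.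
move=> _ [z /= hz <-]; rewrite -ler_pdivlMr // lerBlDr.
exact: one.
Qed.

Theorem theorem4p2 (R : realType) :
  exists C F2 G2 : R, [/\ 0 < C, 0 < F2, 0 < G2 &
  forall (Theta : nat) (a b : R) (nu : R -> R) (N m s : nat)
         (psi : 'I_N.+1 -> {poly R}) (omega : 'cV[R]_N.+1)
         (d : measure_display) (T : measurableType d) (P : probability T R)
         (X : 'I_m -> {RV P >-> R}) (f : R -> R)
         (popt : {poly R}) (copt : 'cV[R]_N.+1),
    (0 < Theta)%N -> a < b -> is_density a b nu ->
    (0 < N)%N -> (0 < m)%N -> (0 < s)%N ->
    m%:R >= C * s%:R * ln s%:R ^+ 3 * ln N.+1%:R ->
    orthonormal_wrt a b nu psi ->
    (forall j k : 'I_N.+1, (j < k)%N -> (size (psi j) < size (psi k))%N) ->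
    (forall j, (size (psi j) <= N.+1)%N) ->
    (forall j, 1 <= omega j 0) ->
    (forall j, supnorm a b (fun x => (psi j).[x]) <= omega j 0) ->
    s%:R >= 2 * `|omega| ^+ 2 ->
    mutually_independent X ->
    (forall i, has_density a b nu (X i)) ->
    {within `[a, b], continuous f} ->
    is_best_approx a b N f popt ->
    popt = lincomb psi copt ->
    let E_N := best_error a b N f in
    with_prob_at_least P (1 - N.+1%:R `^ (- ln (3 * s%:R) ^+ 3)) (fun t =>
      let A : 'M[R]_(m, N.+1) := \matrix_(j, k) (psi k).[X j t] in
      let y : 'cV[R]_m := \col_j f (X j t) in
      forall c : 'cV[R]_N.+1,
        wl1_minimizer omega A y (Theta%:R * Num.sqrt m%:R * E_N) c ->
        L2norm a b nu (fun x => f x - (lincomb psi c).[x])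
          <= L2norm a b nu (fun x => f x - popt.[x])
             + F2 * (wsigma s omega copt / Num.sqrt s%:R)
             + Theta%:R * G2 * E_N)].
Proof.
pose D : R := 64 * (32 * 16); have DE : D = 64 * (32 * 16) by [].
move: D DE => D DE.
have D0 : 0 < D by rewrite DE; lra.
(* The first constant is what [net_failure] requires of m; 1 and 20 come from
   [recovery_of_lower_bound]. *)
exists (3200 * (16 * D + 128)), 1, 20; split.
- by apply: mulr_gt0; [rewrite ltr0n|lra].
- exact: ltr01.
- by rewrite ltr0n.
move=> Theta a b nu N m s psi omega d T P X f popt copt Theta0 ab dnu N0 m0 s0.
move=> hm orth _ _ omega1 psiB s_omega indep dX cf [_ poptE] poptc E_N.
(* Since the max norm of omega is at least omega_0 >= 1, the assumption s >= 2 |omega|^2 gives s >=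
   2, so that ln s is bounded below. *)
have s2 : (2 <= s)%N.
  have n1 : 1 <= `|omega|.
    exact: le_trans (omega1 0) (le_trans (ler_norm _) (le_mx_norm_col _ _)).
  rewrite -(ler_nat R); apply: le_trans s_omega.
  by rewrite -[leLHS]mulr1 ler_pM2l // expr_ge1.
have omega0 j : 0 < omega j 0 by apply: lt_le_trans (omega1 j).
have cpoly (p : {poly R}) : {within `[a, b], continuous (fun x => p.[x])}.
  by apply: continuous_subspaceT; exact: continuous_horner.
have psi_le j x : x \in `[a, b] -> `|(psi j).[x]| <= omega j 0.
  by move=> xab; apply: le_trans (psiB j); exact: le_supnorm.
have resid x : x \in `[a, b] -> `|f x - popt.[x]| <= E_N.
  move=> xab; rewrite -[leRHS]poptE; apply: (le_supnorm ab _ xab).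
  by move=> z; apply: continuousB; [exact: cf|exact: cpoly].
have E0 : 0 <= E_N.
  apply: le_trans (resid a _); first by [].
  by rewrite in_itv /= lexx ltW.
have [n [n1 n2 n3 n4]] := dyadic_depth R s2.
have q0 : 0 < Num.sqrt s%:R :> R by rewrite sqrtr_gt0 ltr0n.
have q2 : Num.sqrt s%:R ^+ 2 = s%:R :> R by rewrite sqr_sqrtr.
have B0 : 0 < 4 * Num.sqrt s%:R :> R by rewrite mulr_gt0.
have Bn : 4 * Num.sqrt s%:R < 2 ^+ n / 2 :> R.
  rewrite -(@ltr_pXn2r _ 2) ?nnegrE ?ltW ?divr_gt0 ?exprn_gt0 //.
  by rewrite !exprMn q2 sqr_pow2 !expr2; lra.
have tauB i : (i < n)%N -> (2 : R) ^+ i / 2 <= 16 * (4 * Num.sqrt s%:R).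
  move=> /n1 hi; rewrite -(@ler_pXn2r _ 2) ?nnegrE ?mulr_ge0 ?sqrtr_ge0 ?exprn_ge0 //.
  rewrite !exprMn q2 sqr_pow2 !expr2.
  have : 0 <= s%:R :> R by [].
  lra.
have [E [mE PE hE]] := uniform_lower_bound ab dnu m0 indep dX orth omega0 psi_le
  B0 (L := net_size s (ln s%:R) D) (e := net_tolerance s (ln s%:R))
  (fun _ _ => isT) Bn tauB
  (fun i _ => net_size_precision s2 erefl DE i)
  (sum_net_tolerance s2 erefl n3 n4).
exists (~` E); split; first exact: measurableC.
- rewrite probability_setC // EFinB leeB //.
  apply: le_trans PE _; rewrite lee_fin.
  exact: (net_failure N0 s2 erefl erefl DE n1 n4 hm).
move=> t /hE[tab lower] A y c cmin.
have Ax (v : 'cV[R]_N.+1) i : (A *m v) i 0 = (lincomb psi v).[X i t].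
  rewrite !mxE /lincomb horner_sum; apply: eq_bigr => k _.
  by rewrite mxE hornerZ mulrC.
have bu : bdmeas a b (fun x => f x - popt.[x]).
  by apply: bdmeasB; [exact: bdmeas_continuous|exact: bdmeas_poly].
(* Splitting off the polynomial with coefficients [c - copt] keeps the constant 1 on the
   best-approximation error; by orthonormality, the L2 norm of that polynomial is the l2 norm of its
   coefficients. *)
have -> : (fun x => f x - (lincomb psi c).[x]) =
    (fun x => f x - popt.[x] - (lincomb psi (c - copt)).[x]).
  apply/funext => x; rewrite poptc /lincomb !horner_sum.
  rewrite -addrA -opprD -big_split /=; congr (_ - _); apply: eq_bigr => k _.
  by rewrite !hornerZ !mxE; ring.
apply: le_trans (L2norm_sub_le dnu bu (bdmeas_poly _ ab)) _.
rewrite -addrA lerD2l mul1r.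
have -> : L2norm a b nu (fun x => (lincomb psi (c - copt)).[x]) = l2norm (c - copt).
  by rewrite /L2norm -/(wint a b nu (fun x => (lincomb psi (c - copt)).[x] ^+ 2))
    wint_lincomb_sqr.
apply: (recovery_of_lower_bound m0 s0 _ _ E0 _ _ cmin).
- by move=> j; exact: ltW.
- by rewrite (ler_nat _ 1).
- by move=> i; rewrite mxE Ax !mxE -poptc -normrN opprB resid.
- move=> v /lower; rewrite (sqr_l2norm (A *m v)).
  by under [in X in _ -> X]eq_bigr do rewrite Ax.
Qed.
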